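(* Let $E\subseteq\mathbb{Z}$ and let $p\ne2,4$ be an even integer (so $p\ge6$). If $L^p_E(\mathbb{T})$ has real umap, then $d^*(E)=0$.
   Context: $\mathbb{T}=\{z\in\mathbb{C}:|z|=1\}$ with normalized Haar measure $m$; $L^p_E(\mathbb{T})$ is the space of complex-valued $f\in L^p(\mathbb{T})$ with $\widehat f(n)=\int f(z)z^{-n}\,dm(z)=0$ for all $n\notin E$. The maximal density of $E$ is $d^*(E)=\lim_{h\to\infty}\max_{a\in\mathbb{Z}}\frac{|E\cap\{a+1,\dots,a+h\}|}{h}$. A separable Banach space $Y$ has real umap (metric unconditional approximation property) if for every $\varepsilon>0$ there is a sequence $\{T_k\}_{k\ge1}$ of bounded finite-rank operators on $Y$ with $T_ky\to y$ for all $y\in Y$ such that, with $T_0=0$, $\|\sum_{k=1}^n\epsilon_k(T_k-T_{k-1})\|\le1+\varepsilon$ for all $n$ and all $\epsilon_k\in\{-1,1\}$. *)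

(* Defs.v *)
From HB Require Import structures.
From mathcomp Require Import all_boot all_order all_algebra.
From mathcomp Require Import complex.
From mathcomp Require Import all_classical all_reals all_analysis.
From mathcomp Require Import measurable_realfun.

Set Implicit Arguments.
Unset Strict Implicit.
Unset Printing Implicit Defensive.
Import Order.TTheory GRing.Theory Num.Theory.
Import numFieldNormedType.Exports.
Import ComplexField.Normc.

Local Open Scope classical_set_scope.
Local Open Scope complex_scope.
Local Open Scope quotient_scope.
Local Open Scope ring_scope.

Section complex_functions.
Context d (T : measurableType d) (R : realType).
Implicit Types (f g : T -> R[i]).

Definition cmeasurable f :=
  measurable_fun [set: T] (fun x => complex.Re (f x)) /\
  measurable_fun [set: T] (fun x => complex.Im (f x)).

Lemma cmeasurable_normc f :
  cmeasurable f -> measurable_fun [set: T] (fun x => normc (f x)).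
Proof.
move=> [mR mI].
rewrite (_ : (fun x => _) =
  (fun x => Num.sqrt (complex.Re (f x) ^+ 2 + complex.Im (f x) ^+ 2))); last first.
  by apply/funext => x; case: (f x).
apply: measurableT_comp => //.
  apply: continuous_measurable_fun; exact: sqrt_continuous.
by apply: measurable_funD; exact: measurable_funX.
Qed.

Lemma cmeasurable_lin (a : R[i]) f g :
  cmeasurable f -> cmeasurable g -> cmeasurable (a *: f + g).
Proof.
move=> [fR fI] [gR gI]; split.
- rewrite (_ : (fun x => _) = (fun x =>
    complex.Re a * complex.Re (f x) - complex.Im a * complex.Im (f x) + complex.Re (g x))); last first.
    by apply/funext => x /=; rewrite !fctE /GRing.scale/=;
       case: (f x) (g x) a => ? ? [? ?] [? ?].
  by apply: measurable_funD => //; apply: measurable_funB => //;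
     apply: measurable_funM.
- rewrite (_ : (fun x => _) = (fun x =>
    complex.Re a * complex.Im (f x) + complex.Im a * complex.Re (f x) + complex.Im (g x))); last first.
    by apply/funext => x /=; rewrite !fctE /GRing.scale/=;
       case: (f x) (g x) a => ? ? [? ?] [? ?].
  by apply: measurable_funD => //; apply: measurable_funD => //;
     apply: measurable_funM.
Qed.

End complex_functions.

Section complex_Lp.
Context d (T : measurableType d) (R : realType).
Variable mu : {measure set T -> \bar R}.
Implicit Types (f g : T -> R[i]).

Definition cLnorm (p : R) f : \bar R :=
  'N[mu]_p%:E[EFin \o (fun x => normc (f x))]%E.

Definition cLfun (p : R) : {pred T -> R[i]} :=
  mem [set f | cmeasurable f /\ (cLnorm p f < +oo)%E].

Variables (p : R) (p1 : 1 <= p).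

Lemma ge0_le_Lnorm (u v : T -> R) :
  measurable_fun [set: T] u -> measurable_fun [set: T] v ->
  (forall x, 0 <= u x <= v x) ->
  ('N[mu]_p%:E[EFin \o u] <= 'N[mu]_p%:E[EFin \o v])%E.
Proof.
move=> mu_ mv uv; rewrite unlock /=.
have p0 : 0 <= p by rewrite (le_trans _ p1).
apply: gt0_ler_poweR.
- by rewrite invr_ge0.
- by rewrite in_itv/= leey integral_ge0// => x _; exact: poweR_ge0.
- by rewrite in_itv/= leey integral_ge0// => x _; exact: poweR_ge0.
apply: ge0_le_integral => //=.
- apply/measurable_EFinP.
  apply: (measurableT_comp (measurable_powR _)) => //.
  exact: measurableT_comp.
- apply/measurable_EFinP.
  apply: (measurableT_comp (measurable_powR _)) => //.
  exact: measurableT_comp.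
- move=> x _; have /andP[u0 uvx] := uv x.
  rewrite lee_fin ge0_ler_powR// ?nnegrE//.
  by rewrite !ger0_norm// (le_trans u0).
Qed.

Lemma normc_ge0 (z : R[i]) : 0 <= normc z.
Proof. by case: z => a b; exact: sqrtr_ge0. Qed.

Lemma cLnormD f g : cmeasurable f -> cmeasurable g ->
  (cLnorm p (f + g)%R <= cLnorm p f + cLnorm p g)%E.
Proof.
move=> mf mg.
have mfg : cmeasurable (f + g) by rewrite -[f]scale1r; exact: cmeasurable_lin.
apply: (@le_trans _ _ ('N[mu]_p%:E[EFin \o
   ((fun x => normc (f x)) \+ (fun x => normc (g x)))%R])%E).
  apply: ge0_le_Lnorm.
  - exact: cmeasurable_normc.
  - by apply: measurable_funD; exact: cmeasurable_normc.
  - by move=> x; rewrite normc_ge0/=; exact: le_normcD.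
apply: eminkowski => //; exact: cmeasurable_normc.
Qed.

Lemma cLnormZ (a : R[i]) f : cmeasurable f ->
  (cLnorm p (a *: f)%R = (normc a)%:E * cLnorm p f)%E.
Proof.
move=> mf; have p0 : 0 < p by exact: lt_le_trans p1.
rewrite /cLnorm unlock/=.
under eq_integral => x _.
  rewrite (_ : normc _ = normc a * normc (f x)); last exact: normcM.
  rewrite normrM powRM// EFinM.
  over.
rewrite /= ge0_integralZl_EFin//; last 1 first.
- apply/measurable_EFinP.
  apply: (measurableT_comp (measurable_powR _)) => //.
  by apply: measurableT_comp => //; exact: cmeasurable_normc.
rewrite poweRM; last 2 first.
- by rewrite lee_fin powR_ge0.
- by apply: integral_ge0 => x _; rewrite lee_fin powR_ge0.
rewrite poweR_EFin -powRrM mulfV ?gt_eqF// powRr1//.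
by rewrite ger0_norm// normc_ge0.
Qed.

Lemma cLnorm0 : cLnorm p 0 = 0%E.
Proof.
rewrite /cLnorm (_ : EFin \o _ = cst 0%E).
  by rewrite Lnorm0// eqe gt_eqF// (lt_le_trans _ p1).
by apply/funext => x; congr EFin; exact: normc0.
Qed.

Lemma cLfun_submod_closed : submod_closed (cLfun p).
Proof.
split.
  rewrite inE/=; split; last by rewrite cLnorm0.
  by split; exact: measurable_cst.
move=> a f g /[!inE]/= -[mf lf] [mg lg]; split.
  exact: cmeasurable_lin.
have maf : cmeasurable (a *: f).
  rewrite -[_ *: _]addr0; apply: cmeasurable_lin => //.
apply: (le_lt_trans (cLnormD maf mg)).
rewrite lte_add_pinfty// cLnormZ// lte_mul_pinfty// lee_fin; exact: normc_ge0.
Qed.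

HB.instance Definition _ := GRing.isSubmodClosed.Build _ _ (cLfun p)
  cLfun_submod_closed.

(* As for LfunType, the proof of 1 <= p is a phantom parameter: it is there so
   that the canonical structures below can be inferred. *)
Record cLfunType (p1' : 1 <= p) : Type :=
  CLfun { cLfun_fun :> T -> R[i] ; cLfunP : cLfun_fun \in cLfun p }.

HB.instance Definition _ := [isSub for @cLfun_fun p1].
HB.instance Definition _ := gen_eqMixin (cLfunType p1).
HB.instance Definition _ := gen_choiceMixin (cLfunType p1).
HB.instance Definition _ := [SubChoice_isSubLmodule of cLfunType p1 by <:].

Definition caeeq (f g : cLfunType p1) := `[< \forall x \ae mu, f x = g x >].

Let caeeq_refl : reflexive caeeq.
Proof. by move=> f; apply/asboolP/nearW. Qed.

Let caeeq_sym : symmetric caeeq.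
Proof.
by move=> f g; apply/asboolP/asboolP; apply: filterS => x ->.
Qed.

Let caeeq_trans : transitive caeeq.
Proof.
move=> f g h /asboolP gf /asboolP fh; apply/asboolP.
by apply: filterS2 gf fh => x -> ->.
Qed.

Canonical caeeq_equiv := EquivRel caeeq caeeq_refl caeeq_sym caeeq_trans.

(* The space of complex-valued L^p functions, modulo equality mu-a.e.; its norm
   is valued in R[i], as required of a normed module over R[i]. *)
Definition cLp := {eq_quot caeeq}.
HB.instance Definition _ := Choice.on cLp.
HB.instance Definition _ := EqQuotient.on cLp.

Lemma cLpP (f g : cLfunType p1) :
  \pi_cLp f = \pi_cLp g <-> \forall x \ae mu, f x = g x.
Proof.
split=> [/eqP|fg]; first by rewrite eqmodE => /asboolP.
by apply/eqP; rewrite eqmodE; exact/asboolP.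
Qed.

Lemma cLp_reprP (f : cLfunType p1) :
  \forall x \ae mu, (repr (\pi_cLp f) : cLfunType p1) x = f x.
Proof. by apply/cLpP; rewrite reprK. Qed.

Lemma cLp_pi (u : cLp) : exists f : cLfunType p1, u = \pi_cLp f.
Proof. by exists (repr u); rewrite reprK. Qed.

Definition cLp_zero : cLp := \pi_cLp 0.
Definition cLp_opp (u : cLp) : cLp := \pi_cLp (- repr u).
Definition cLp_add (u v : cLp) : cLp := \pi_cLp (repr u + repr v).
Definition cLp_scale (a : R[i]) (u : cLp) : cLp := \pi_cLp (a *: repr u).

Lemma pi_cLp_opp (f : cLfunType p1) : cLp_opp (\pi_cLp f) = \pi_cLp (- f).
Proof.
apply/cLpP; apply: filterS (cLp_reprP f) => x fx.
by rewrite -[LHS]/(- cLfun_fun (repr (\pi_cLp f)) x) fx.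
Qed.

Lemma pi_cLp_add (f g : cLfunType p1) : cLp_add (\pi_cLp f) (\pi_cLp g) = \pi_cLp (f + g).
Proof.
apply/cLpP; apply: filterS2 (cLp_reprP f) (cLp_reprP g) => x fx gx.
by rewrite -[LHS]/(cLfun_fun (repr (\pi_cLp f)) x +
  cLfun_fun (repr (\pi_cLp g)) x) fx gx.
Qed.

Lemma pi_cLp_scale a (f : cLfunType p1) : cLp_scale a (\pi_cLp f) = \pi_cLp (a *: f).
Proof.
apply/cLpP; apply: filterS (cLp_reprP f) => x fx.
by rewrite -[LHS]/(a *: cLfun_fun (repr (\pi_cLp f)) x) fx.
Qed.

Let cLp_addA : associative cLp_add.
Proof.
move=> u v w; have [f ->] := cLp_pi u; have [g ->] := cLp_pi v; have [h ->] := cLp_pi w.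
by rewrite !pi_cLp_add addrA.
Qed.
Let cLp_addC : commutative cLp_add.
Proof.
move=> u v; have [f ->] := cLp_pi u; have [g ->] := cLp_pi v; by rewrite !pi_cLp_add addrC.
Qed.
Let cLp_add0 : left_id cLp_zero cLp_add.
Proof. move=> u; have [f ->] := cLp_pi u; by rewrite pi_cLp_add add0r. Qed.
Let cLp_addN : left_inverse cLp_zero cLp_opp cLp_add.
Proof. move=> u; have [f ->] := cLp_pi u; by rewrite pi_cLp_opp pi_cLp_add addNr. Qed.

HB.instance Definition _ :=
  GRing.isZmodule.Build cLp cLp_addA cLp_addC cLp_add0 cLp_addN.

Let cLp_scaleA a b u : cLp_scale a (cLp_scale b u) = cLp_scale (a * b) u.
Proof. by have [f ->] := cLp_pi u; rewrite !pi_cLp_scale scalerA. Qed.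
Let cLp_scale1 : left_id 1 cLp_scale.
Proof. move=> u; have [f ->] := cLp_pi u; by rewrite pi_cLp_scale scale1r. Qed.
Let cLp_scaleDr : right_distributive cLp_scale +%R.
Proof.
move=> a u v; have [f ->] := cLp_pi u; have [g ->] := cLp_pi v.
rewrite -[_ + _]/(cLp_add _ _).
by rewrite -[RHS]/(cLp_add _ _) !(pi_cLp_scale, pi_cLp_add) scalerDr.
Qed.
Let cLp_scaleDl u (a b : R[i]) :
  cLp_scale (a + b) u = cLp_scale a u + cLp_scale b u.
Proof.
have [f ->] := cLp_pi u; rewrite -[RHS]/(cLp_add _ _).
by rewrite !(pi_cLp_scale, pi_cLp_add) scalerDl.
Qed.

HB.instance Definition _ := GRing.Zmodule_isLmodule.Build R[i] cLp
  cLp_scaleA cLp_scale1 cLp_scaleDr cLp_scaleDl.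

Lemma cLfun_finite (f : cLfunType p1) :
  (fine (cLnorm p f))%:E = cLnorm p f.
Proof.
rewrite fineK// fin_numElt (lt_le_trans ltNy0) ?Lnorm_ge0//=.
by have := cLfunP f; rewrite inE => -[].
Qed.

Lemma cLfun_meas (f : cLfunType p1) : cmeasurable f.
Proof. by have := cLfunP f; rewrite inE => -[]. Qed.

Definition cLp_norm (u : cLp) : R[i] := (fine (cLnorm p (repr u)))%:C.

Lemma cLnorm_ae (f g : T -> R[i]) : cmeasurable f -> cmeasurable g ->
  (\forall x \ae mu, f x = g x) -> cLnorm p f = cLnorm p g.
Proof.
move=> mf mg fg; rewrite /cLnorm unlock; congr (_ `^ _)%E.
apply: ae_eq_integral => //.
- apply/measurable_EFinP.
  apply: (measurableT_comp (measurable_powR _)) => //.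
  by apply: measurableT_comp => //; exact: cmeasurable_normc.
- apply/measurable_EFinP.
  apply: (measurableT_comp (measurable_powR _)) => //.
  by apply: measurableT_comp => //; exact: cmeasurable_normc.
- by apply: filterS fg => x fgx _ /=; rewrite fgx.
Qed.

Lemma cLp_norm_pi (f : cLfunType p1) : cLp_norm (\pi_cLp f) = (fine (cLnorm p f))%:C.
Proof.
rewrite /cLp_norm (@cLnorm_ae _ f)//; [exact: cLfun_meas..|exact: cLp_reprP].
Qed.

Let cLp_ler_normD u v : cLp_norm (u + v) <= cLp_norm u + cLp_norm v.
Proof.
have [f ->] := cLp_pi u; have [g ->] := cLp_pi v.
rewrite -[_ + _]/(cLp_add _ _) pi_cLp_add !cLp_norm_pi -rmorphD lecR.
rewrite -lee_fin EFinD !cLfun_finite.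
exact: (cLnormD (cLfun_meas f) (cLfun_meas g)).
Qed.

Let cLp_normrZ a u : cLp_norm (a *: u) = `|a| * cLp_norm u.
Proof.
have [f ->] := cLp_pi u; rewrite -[_ *: _]/(cLp_scale _ _) pi_cLp_scale !cLp_norm_pi.
rewrite cLnormZ; last exact: cLfun_meas.
by rewrite -cLfun_finite/= -[`|a|]/((normc a)%:C) -rmorphM.
Qed.

Let cLp_normr0_eq0 u : cLp_norm u = 0 -> u = 0.
Proof.
have [f ->] := cLp_pi u; rewrite cLp_norm_pi => /complexI/eqP.
rewrite -eqe cLfun_finite => /eqP f0; apply/cLpP.
have /Lnorm_eq0_eq0 : measurable_fun setT (EFin \o (fun x => normc (f x))).
  by apply/measurable_EFinP/cmeasurable_normc/cLfun_meas.
move=> /(_ mu p%:E); rewrite lte_fin (lt_le_trans _ p1)// => /(_ isT f0).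
by apply: filterS => x /(_ I) [] /eq0_normc.
Qed.

HB.instance Definition _ := Lmodule_isNormed.Build R[i] cLp
  cLp_ler_normD cLp_normrZ cLp_normr0_eq0.

End complex_Lp.

Section circle.
Variable R : realType.

Definition unit_complex : Type := {z : R[i] | `|z| == 1}.
HB.instance Definition _ := Choice.on unit_complex.

Lemma norm1_unit : `|1 : R[i]| == 1. Proof. by rewrite normr1. Qed.
HB.instance Definition _ :=
  isPointed.Build unit_complex (exist _ 1 norm1_unit).

Definition circle_coord (z : unit_complex) : R * R :=
  (complex.Re (val z), complex.Im (val z)).

(* The sigma-algebra is the trace on the circle of the Borel sets of R * R. *)
Definition circle : Type := g_sigma_algebra_preimageType circle_coord.
HB.instance Definition _ := Measurable.on circle.

Definition circle_val (z : circle) : R[i] := val (z : unit_complex).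

Lemma normc_circle (z : circle) : normc (circle_val z) = 1.
Proof. have /eqP/(congr1 (@complex.Re R)) := valP (z : unit_complex).
by []. Qed.

Lemma circle_exp_subproof (t : R) :
  `|cos (2 * pi * t) +i* sin (2 * pi * t) : R[i]| == 1.
Proof. by rewrite -[`|_|]/((Num.sqrt _)%:C) cos2Dsin2 sqrtr1. Qed.

Definition circle_exp (t : measurableTypeR R) : circle :=
  exist (fun z : R[i] => `|z| == 1) _ (circle_exp_subproof t).

Lemma measurable_circle_coord :
  measurable_fun [set: circle] (circle_coord : circle -> R * R).
Proof. by move=> _ B mB; exists B. Qed.

Lemma measurable_circle_exp : measurable_fun [set: measurableTypeR R] circle_exp.
Proof.
move=> _ _ [B mB <-]; rewrite !setTI.
have /(_ measurableT _ mB) : measurable_fun [set: measurableTypeR R]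
    (fun t => (cos (2 * pi * t), sin (2 * pi * t)) : R * R).
  apply: measurable_fun_pair.
  - apply: measurableT_comp; last exact: mulrl_measurable.
    by apply: continuous_measurable_fun; exact: continuous_cos.
  - apply: measurableT_comp; last exact: mulrl_measurable.
    by apply: continuous_measurable_fun; exact: continuous_sin.
by rewrite setTI.
Qed.

HB.instance Definition _ :=
  isMeasurableFun.Build _ _ _ _ circle_exp measurable_circle_exp.

(* Normalized Haar measure: the law of exp(2 i pi t) for t uniform in [0, 1]. *)
Definition haar : probability circle R :=
  distribution (uniform_prob (@ltr01 R)) circle_exp.

End circle.

Section complex_integral.
Context d (T : measurableType d) (R : realType).
Implicit Types f g w : T -> R[i].

Definition cintegral (mu : {measure set T -> \bar R}) f : R[i] :=
  (\int[mu]_x complex.Re (f x)) +i* (\int[mu]_x complex.Im (f x)).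

Lemma cmeasurableM f g : cmeasurable f -> cmeasurable g -> cmeasurable (f \* g).
Proof.
move=> [fR fI] [gR gI]; split.
- rewrite (_ : (fun x => _) = (fun x =>
    complex.Re (f x) * complex.Re (g x) - complex.Im (f x) * complex.Im (g x))).
    by apply: measurable_funB; apply: measurable_funM.
  by apply/funext => x /=; case: (f x) (g x) => ? ? [? ?].
- rewrite (_ : (fun x => _) = (fun x =>
    complex.Re (f x) * complex.Im (g x) + complex.Im (f x) * complex.Re (g x))).
    by apply: measurable_funD; apply: measurable_funM.
  by apply/funext => x /=; case: (f x) (g x) => ? ? [? ?].
Qed.

Lemma Re_le_normc (z : R[i]) : `|complex.Re z| <= normc z.
Proof.
case: z => a b /=; rewrite -sqrtr_sqr ler_wsqrtr// lerDl; exact: sqr_ge0.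
Qed.

Lemma Im_le_normc (z : R[i]) : `|complex.Im z| <= normc z.
Proof.
case: z => a b /=; rewrite -sqrtr_sqr ler_wsqrtr// lerDr; exact: sqr_ge0.
Qed.

Variables (mu : {finite_measure set T -> \bar R}) (p : R) (p1 : 1 <= p).

Lemma cLfun_integrable f w : f \in cLfun mu p -> cmeasurable w ->
    (forall x, normc (w x) = 1) ->
  mu.-integrable [set: T] (EFin \o (fun x => complex.Re (f x * w x))) /\
  mu.-integrable [set: T] (EFin \o (fun x => complex.Im (f x * w x))).
Proof.
rewrite inE => -[mf lf] mw w1.
have mfw := cmeasurableM mf mw.
have nf : (fun x => normc (f x)) \in Lfun mu p%:E.
  by apply/andP; split; rewrite inE//=; exact: cmeasurable_normc.
have p1E : (1 <= p%:E)%E by rewrite lee_fin.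
have /Lfun1_integrable nf1 : (fun x => normc (f x)) \in Lfun mu 1%:E.
  exact: (@Lfun_subset _ _ _ mu 1%E p%:E (lexx _) p1E
    (fin_num_measure mu _ measurableT) p1E).
split; apply: le_integrable nf1 => //; try exact/measurable_EFinP/(proj1 mfw);
  try exact/measurable_EFinP/(proj2 mfw); move=> x _ /=;
  rewrite lee_fin (ger0_norm (normc_ge0 _)).
- by rewrite (le_trans (Re_le_normc _))// normcM w1 mulr1.
- by rewrite (le_trans (Im_le_normc _))// normcM w1 mulr1.
Qed.

Lemma cintegral_lin f g w (a : R[i]) : f \in cLfun mu p -> g \in cLfun mu p ->
    cmeasurable w -> (forall x, normc (w x) = 1) ->
  cintegral mu (fun x => (a *: f + g) x * w x) =
  a * cintegral mu (fun x => f x * w x) + cintegral mu (fun x => g x * w x).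
Proof.
move=> lf lg mw w1.
have [fR fI] := cLfun_integrable lf mw w1.
have [gR gI] := cLfun_integrable lg mw w1.
have iZ (c : R) (h : T -> R) : mu.-integrable setT (EFin \o h) ->
    mu.-integrable setT (EFin \o (fun x => c * h x)).
  by move=> /(integrableZl measurableT c).
have iB (h k : T -> R) : mu.-integrable setT (EFin \o h) ->
    mu.-integrable setT (EFin \o k) ->
    mu.-integrable setT (EFin \o (fun x => h x - k x)).
  by move=> ih ik; have := integrableB measurableT ih ik.
have iD (h k : T -> R) : mu.-integrable setT (EFin \o h) ->
    mu.-integrable setT (EFin \o k) ->
    mu.-integrable setT (EFin \o (fun x => h x + k x)).
  by move=> ih ik; have := integrableD measurableT ih ik.
have eR : (fun x => complex.Re ((a *: f + g) x * w x)) =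
    (fun x => complex.Re a * complex.Re (f x * w x) -
       complex.Im a * complex.Im (f x * w x) + complex.Re (g x * w x)).
  apply/funext => x; rewrite -[(a *: f + g) x]/(a * f x + g x) mulrDl -mulrA.
  by case: (f x * w x) (g x * w x) a => ? ? [? ?] [? ?].
have eI : (fun x => complex.Im ((a *: f + g) x * w x)) =
    (fun x => complex.Re a * complex.Im (f x * w x) +
       complex.Im a * complex.Re (f x * w x) + complex.Im (g x * w x)).
  clear eR; apply/funext => x; rewrite -[(a *: f + g) x]/(a * f x + g x) mulrDl -mulrA.
  by case: (f x * w x) (g x * w x) a => ? ? [? ?] [? ?].
rewrite /cintegral eR eI.
rewrite RintegralD//; [|by apply: iB; exact: iZ].
rewrite RintegralB//; [|exact: iZ..].
rewrite [in X in _ +i* X]RintegralD//; [|by apply: iD; exact: iZ].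
rewrite [in X in _ +i* X]RintegralD//; [|exact: iZ..].
rewrite !RintegralZl//.
by case: a {eR eI}.
Qed.

Lemma cintegral_ae f g w : f \in cLfun mu p -> g \in cLfun mu p ->
    cmeasurable w -> (\forall x \ae mu, f x = g x) ->
  cintegral mu (fun x => f x * w x) = cintegral mu (fun x => g x * w x).
Proof.
rewrite !inE => -[mf _] [mg _] mw fg.
have [fR fI] := cmeasurableM mf mw.
have [gR gI] := cmeasurableM mg mw.
rewrite /cintegral; congr (_ +i* _); congr fine; apply: ae_eq_integral => //;
  try (exact/measurable_EFinP); by apply: filterS fg => x /= -> _.
Qed.

End complex_integral.

Section LpE.
Variable R : realType.

Definition fourier_coef (f : circle R -> R[i]) (n : int) : R[i] :=
  cintegral (haar R) (fun z => f z * circle_val z ^ (- n)).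

Lemma cmeasurable_circle_val : cmeasurable (@circle_val R).
Proof.
split.
- exact: (measurableT_comp measurable_fst (@measurable_circle_coord R)).
- exact: (measurableT_comp measurable_snd (@measurable_circle_coord R)).
Qed.

Lemma normcX (z : R[i]) n : normc (z ^+ n) = normc z ^+ n.
Proof.
by elim: n => [|n IH]; rewrite ?normc1// !exprS normcM IH.
Qed.

Lemma normc_circleX (n : int) (z : circle R) : normc (circle_val z ^ n) = 1.
Proof.
by case: n => n; rewrite ?NegzE -?exprnP -?exprnN ?normcV normcX normc_circle
  expr1n ?invr1.
Qed.

Lemma cmeasurable_circleX (n : int) :
  cmeasurable (fun z : circle R => circle_val z ^ n).
Proof.
have mX k : cmeasurable (fun z : circle R => circle_val z ^+ k).
  elim: k => [|k IH]; first by split; exact: measurable_cst.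
  rewrite (_ : (fun z => _) =
     (@circle_val R) \* (fun z => circle_val z ^+ k)); last first.
    by apply/funext => z; rewrite exprS.
  exact: cmeasurableM cmeasurable_circle_val IH.
case: n => n; first exact: mX.
have [mR mI] := mX n.+1.
have E z : circle_val z ^ Negz n = conjc (circle_val z ^+ n.+1) :> R[i].
  rewrite NegzE -exprnN invc_norm.
  rewrite -[`|_|]/((normc (circle_val z ^+ n.+1))%:C) normcX normc_circle.
  by rewrite !expr1n invr1 mul1r.
split.
- rewrite (_ : (fun z => _) = fun z => complex.Re (circle_val z ^+ n.+1))//.
  by apply/funext => z; rewrite E; case: (_ ^+ _).
- rewrite (_ : (fun z => _) = fun z => - complex.Im (circle_val z ^+ n.+1)).
    exact: measurableT_comp.
  by apply/funext => z; rewrite E; case: (_ ^+ _).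
Qed.

Variables (E : set int) (p : R) (p1 : 1 <= p).

(* Fourier coefficients do not depend on the representative: cf.
   fourier_coef_pi below. *)
Definition LpE_pred : {pred cLp (haar R) p1} :=
  mem [set u : cLp (haar R) p1 |
    forall n, ~ E n -> fourier_coef (repr u) n = 0].

Lemma fourier_coef_pi (f : cLfunType (haar R) p1) n :
  fourier_coef (repr (\pi_(cLp (haar R) p1) f)) n = fourier_coef f n.
Proof.
apply: (@cintegral_ae _ _ _ _ p); [exact: cLfunP..| |exact: cLp_reprP].
exact: cmeasurable_circleX.
Qed.

Lemma fourier_coef_lin (a : R[i]) (u v : cLp (haar R) p1) n :
  fourier_coef (repr (a *: u + v)) n =
  a * fourier_coef (repr u) n + fourier_coef (repr v) n.
Proof.
have [f ->] := cLp_pi u; have [g ->] := cLp_pi v.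
rewrite -[_ *: _]/(cLp_scale _ _) -[_ + _ : cLp _ _]/(cLp_add _ _).
rewrite pi_cLp_scale pi_cLp_add !fourier_coef_pi.
apply: (@cintegral_lin _ _ _ _ p) => //; [exact: cLfunP..| |].
- exact: cmeasurable_circleX.
- exact: normc_circleX.
Qed.

Lemma LpE_submod_closed : submod_closed LpE_pred.
Proof.
split.
  rewrite inE/= => n _.
  have := fourier_coef_lin (-1) 0 0 n.
  by rewrite scaler0 addr0 mulN1r addNr.
move=> a u v /[!inE]/= Eu Ev n En.
by rewrite fourier_coef_lin Eu// Ev// mulr0 addr0.
Qed.

HB.instance Definition _ :=
  GRing.isSubmodClosed.Build _ _ LpE_pred LpE_submod_closed.

Record LpE : Type := { LpE_val : cLp (haar R) p1 ; _ : LpE_val \in LpE_pred }.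

HB.instance Definition _ := [isSub for LpE_val].
HB.instance Definition _ := [Choice of LpE by <:].
HB.instance Definition _ := [SubChoice_isSubLmodule of LpE by <:].

Definition LpE_norm (u : LpE) : R[i] := `|LpE_val u|.

Let LpE_ler_normD u v : LpE_norm (u + v) <= LpE_norm u + LpE_norm v.
Proof. exact: ler_normD. Qed.
Let LpE_normrZ a u : LpE_norm (a *: u) = `|a| * LpE_norm u.
Proof. exact: normrZ. Qed.
Let LpE_normr0_eq0 u : LpE_norm u = 0 -> u = 0.
Proof. by move=> /normr0_eq0 u0; exact: val_inj. Qed.

HB.instance Definition _ := Lmodule_isNormed.Build R[i] LpE
  LpE_ler_normD LpE_normrZ LpE_normr0_eq0.

End LpE.

Section umap.
Variables (K : numFieldType) (Y : normedModType K).

Definition finite_rank (T : Y -> Y) :=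
  exists (n : nat) (e : 'I_n -> Y), forall y, exists c : 'I_n -> K,
    T y = \sum_(i < n) c i *: e i.

Definition opnorm_le (T : Y -> Y) (M : K) := forall y, `|T y| <= M * `|y|.

(* For K = R[i], the hypothesis 0 < eps forces eps to be real. T k is T_k for
   k >= 1, and T 0 = 0 is the usual convention. *)
Definition real_umap := forall eps : K, 0 < eps ->
  exists T : nat -> {linear Y -> Y},
    [/\ forall y, T 0 y = 0,
        forall k, (exists M, opnorm_le (T k) M) /\ finite_rank (T k),
        forall y, T k y @[k --> \oo] --> y
      & forall (n : nat) (e : nat -> K), (forall k, e k = 1 \/ e k = -1) ->
        opnorm_le (fun y => \sum_(1 <= k < n.+1) e k *: (T k y - T k.-1 y))
          (1 + eps)].

End umap.

Section max_density.
Variables (R : realType) (E : set int).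

(* #|E \cap {a + 1, ..., a + h}| *)
Definition window_count (a : int) (h : nat) : nat :=
  \sum_(1 <= i < h.+1) `[< E (a + i%:Z)%R >].

(* The supremum is a maximum, since the counts are naturals bounded by h. *)
Definition max_window_count (h : nat) : R :=
  sup [set (window_count a h)%:R | a in [set: int]].

Definition max_density : R :=
  lim ((max_window_count h / h%:R) @[h --> \oo]).

Lemma window_count_le a h : (window_count a h <= h)%N.
Proof.
apply: (@leq_trans (\sum_(1 <= i < h.+1) 1)%N).
  by apply: leq_sum => i _; exact: leq_b1.
by rewrite sum_nat_const_nat subn1 muln1.
Qed.

Lemma window_countD a m n :
  window_count a (m + n) = (window_count a m + window_count (a + m%:Z) n)%N.
Proof.
rewrite /window_count (@big_cat_nat _ _ _ m.+1)//= ?ltnS ?leq_addr//.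
congr (_ + _)%N; rewrite -{1}[m.+1]add1n big_addn -addnS addnC addnK.
by apply: eq_bigr => i _; rewrite PoszD -addrA (addrC i%:Z).
Qed.

Let has_sup_window h :
  has_sup [set ((window_count a h)%:R : R) | a in [set: int]].
Proof.
split; first by exists (window_count 0 h)%:R; exists 0.
by exists h%:R => _ [a _ <-]; rewrite ler_nat window_count_le.
Qed.

Lemma max_window_count_ub a h : (window_count a h)%:R <= max_window_count h.
Proof. by apply: sup_upper_bound => //; exists a. Qed.

Lemma max_window_count_ge0 h : 0 <= max_window_count h.
Proof. exact: le_trans (max_window_count_ub 0 h). Qed.

Lemma max_window_count_le h : max_window_count h <= h%:R.
Proof.
apply: ge_sup; first by case: (has_sup_window h).
by move=> _ [a _ <-]; rewrite ler_nat window_count_le.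
Qed.

Lemma max_window_countD m n :
  max_window_count (m + n) <= max_window_count m + max_window_count n.
Proof.
apply: ge_sup; first by case: (has_sup_window (m + n)).
move=> _ [a _ <-]; rewrite window_countD natrD.
by apply: lerD; exact: max_window_count_ub.
Qed.

Lemma max_window_countM q m :
  max_window_count (q * m) <= q%:R * max_window_count m.
Proof.
elim: q => [|q IH]; first by rewrite mul0n mul0r max_window_count_le.
rewrite mulSn (le_trans (max_window_countD _ _))// -nat1r mulrDl mul1r.
by rewrite lerD2l.
Qed.

(* The limit defining the maximal density always exists. *)
Lemma is_cvg_max_density : cvg ((max_window_count h / h%:R) @[h --> \oo]).
Proof.
pose u h := max_window_count h / h%:R.
pose A := [set u h.+1 | h in [set: nat]].
have Ainf : has_inf A.
  split; first by exists (u 1%N); exists 0%N.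
  by exists 0 => _ [h _ <-]; rewrite divr_ge0// max_window_count_ge0.
apply/cvg_ex; exists (inf A); apply/cvgrPdist_le => e e0.
have e20 : 0 < e / 2 by rewrite divr_gt0.
have [_ [m _ <-] um] := inf_adherent e20 Ainf.
near=> h.
have h0 : (0 < h)%N by near: h; exact: nbhs_infty_gt.
have hR : 0 < h%:R :> R by rewrite ltr0n.
have lo : inf A <= u h.
  by apply: ge_inf; [case: Ainf|exists h.-1 => //; rewrite prednK].
have up : u h <= u m.+1 + m.+1%:R / h%:R.
  rewrite /u ler_pdivrMr// mulrDl divfK ?gt_eqF//.
  rewrite {1}(divn_eq h m.+1) (le_trans (max_window_countD _ _))//.
  apply: lerD.
    rewrite (le_trans (max_window_countM _ _))// mulrC -mulrA ler_wpM2l//.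
      exact: max_window_count_ge0.
    by rewrite mulrC ler_pdivlMr ?ltr0n// -natrM ler_nat leq_divM.
  rewrite (le_trans (max_window_count_le _))// ler_nat.
  by rewrite ltnW// ltn_mod.
have small : m.+1%:R / h%:R <= e / 2.
  rewrite ler_pdivrMr// mulrC -ler_pdivrMr//; near: h.
  exact: nbhs_infty_ger.
rewrite distrC ger0_norm ?subr_ge0// lerBlDl (le_trans up)//.
by rewrite [e]splitr addrA lerD// ltW.
Unshelve. all: by end_near. Qed.

End max_density.

(* Main.v *)
Require Import Defs.
From mathcomp Require Import all_boot all_order all_algebra.
From mathcomp Require Import complex zify ring lra.
From mathcomp Require Import all_classical all_reals all_analysis.
From mathcomp Require Import measurable_realfun.
Set Implicit Arguments.
Unset Strict Implicit.
Unset Printing Implicit Defensive.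
Import Order.TTheory GRing.Theory Num.Theory.
Import numFieldNormedType.Exports.
Import ComplexField.Normc.
Local Open Scope classical_set_scope.
Local Open Scope complex_scope.
Local Open Scope quotient_scope.
Local Open Scope ring_scope.

(** If E has positive maximal density, a pigeonhole argument on the translates
    E - b (b in E) yields a fixed a in E such that, for b in E arbitrarily far
    away, the equation a + m = b + m' has solutions m, m' in E arbitrarily far
    away. Write p = 2n, f = z^a and g = z^b + z^m + z^m'. Expanding the 2n-th
    power, ||f + g||^p counts the coincidences between sums of n frequencies,
    and ||f - g||^p counts them with a sign, negative when a occurs an odd number
    of times; as n >= 2, the equation above gives such a coincidence, so that
    ||f + g||^p >= ||f - g||^p + 2. But real umap gives a finite rank T with
    T f close to f and 2 T - I of norm almost at most 1; as T is small on the
    characters of large frequency, ||f + g|| is at most ||f - g|| up to an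
    arbitrarily small error. *)

(** * Recurrent differences in sets of positive maximal density *)

Lemma uniform_bound (K : nat) (Q : nat -> nat -> Prop) :
  (forall i B B', (B <= B')%N -> Q i B -> Q i B') ->
  (forall i, (i < K)%N -> exists B, Q i B) ->
  exists B, forall i, (i < K)%N -> Q i B.
Proof.
move=> mono; elim: K => [|K IH] ex; first by exists 0%N.
have [B hB] := IH (fun i iK => ex i (ltnW iK)).
have [B' hB'] := ex K (ltnSn K).
exists (maxn B B') => i; rewrite ltnS leq_eqVlt => /orP[/eqP->|iK].
  by apply: mono hB'; exact: leq_maxr.
by apply: mono (hB i iK); exact: leq_maxl.
Qed.

Section window.
Variable E : set int.

Lemma window_count_count (a : int) h :
  window_count E a h = size [seq x <- [seq a + i%:Z | i <- iota 1 h] | `[< E x >]].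
Proof.
rewrite /window_count size_filter count_map -sum1_count [RHS]big_mkcond.
by rewrite /index_iota subSS subn0; apply: eq_bigr => i _ /=; case: asboolP.
Qed.

Lemma window_count_bounded (B : nat) (a : int) h :
  (forall m, E m -> (`|m| < B)%N) -> (window_count E a h <= B.*2)%N.
Proof.
move=> EB; rewrite window_count_count.
set s := [seq x <- _ | _].
have us : uniq s.
  rewrite filter_uniq// map_inj_uniq ?iota_uniq// => i j /addrI.
  by move=> [].
rewrite -[B.*2](size_iota 0) -(size_map (fun k : nat => k%:Z - B%:Z)).
apply: uniq_leq_size => // x; rewrite mem_filter => /andP[/asboolP /EB xB _].
apply/mapP; exists `|((x : int) + B%:Z)%R|%N; last by lia.
by rewrite mem_iota; lia.
Qed.

Lemma window_count_widen (a : int) h u v :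
  (window_count E a h <= window_count E (a - u%:Z) (u + h + v))%N.
Proof.
by rewrite -addnA !window_countD subrK addnCA leq_addr.
Qed.

(** The translates [E - b] and [E - c] meet only strictly between [-B] and [B]. *)
Definition almost_disjoint (b c : int) (B : nat) :=
  forall n, E (n + b) -> E (n + c) -> (`|n| < B)%N.

End window.

(* The translates [E - b i] meet a window of length [h + 2 * G] in
   [K * window_count a h] points at least, and almost no point is hit twice. *)
Lemma window_count_almost_disjoint (E : set int) (K : nat) (b : nat -> int) (B : nat) :
  (forall i j, (i < j < K)%N -> almost_disjoint E (b i) (b j) B) ->
  exists C : nat, forall a h, (K * window_count E a h <= h + C)%N.
Proof.
move=> bB.
have [G hG] : exists G, forall i, (i < K)%N -> (`|b i| <= G)%N.
  apply: uniform_bound => [i n m nm /leq_trans->//|i _]; by exists `|b i|%N.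
(* [2G] pays for widening the window until it contains all [K] shifted ones; [K * 2B] pays for the
   points of absolute value below [B], each hit at most [K] times. *)
exists (G.*2 + K * B.*2)%N => a h.
pose f n := (\sum_(i < K) `[< E (a - G%:Z + n%:Z + b i)%R >])%N.
have lo : (K * window_count E a h <= \sum_(1 <= n < (h + G.*2).+1) f n)%N.
  rewrite exchange_big/= -[K in leqLHS]card_ord -sum_nat_const.
  apply: leq_sum => i _; have := hG i (ltn_ord i) => biG.
  apply: leq_trans (window_count_widen E a h `|G%:Z - b i| `|G%:Z + b i|) _.
  rewrite /window_count (_ : (_ + h + _ = h + G.*2)%N); last by lia.
  apply: leq_sum => n _; rewrite (_ : a - _ + _ = a - G%:Z + n%:Z + b i)//.
  by lia.
apply: (leq_trans lo).
have hf n : (f n <= 1 + K * `[< (`|(a - G%:Z + n%:Z)%R| < B)%N >])%N.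
  case: asboolP => [_|nB].
    rewrite muln1 (@leq_trans K) ?leq_addl// -[leqRHS]muln1 -[K in leqRHS]card_ord.
    by rewrite -sum_nat_const; apply: leq_sum => i _; exact: leq_b1.
  rewrite muln0 addn0.
  have [/existsP[i Ei]|/existsPn noE] :=
    boolP [exists i : 'I_K, `[< E (a - G%:Z + n%:Z + b i)%R >]].
    rewrite /f (bigD1 i)//= big1 ?addn0 ?leq_b1// => j ji.
    case: asboolP => // Ej; exfalso; apply: nB; move/asboolP: Ei => Ei.
    have [ij|ji'|/val_inj eij] := ltngtP i j; last by rewrite eij eqxx in ji.
      by apply: (bB i j) => //; rewrite ij ltn_ord.
    by apply: (bB j i) => //; rewrite ji' ltn_ord.
  by rewrite /f big1// => i _; rewrite (negbTE (noE i)).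
apply: (@leq_trans (\sum_(1 <= n < (h + G.*2).+1)
    (1 + K * `[< (`|(a - G%:Z + n%:Z)%R| < B)%N >])))%N.
  exact: leq_sum.
rewrite big_split/= sum_nat_const_nat subn1 muln1 -big_distrr/= addnA leq_add2l.
rewrite leq_mul2l; apply/orP; right.
exact: (@window_count_bounded [set m : int | (`|m| < B)%N]).
Qed.

(** Once [h >= C], every window has at most [2h/K] points, so the density is at most [2/K] for every
    [K > 0]. *)
Lemma max_density_eq0 (R : realType) (E : set int) :
  (forall K : nat, exists C : nat, forall a h, (K * window_count E a h <= h + C)%N) ->
  max_density R E = 0.
Proof.
move=> EK; apply: cvg_lim => //; apply/cvgr0Pnorm_le => e e0.
have [K eK] : exists K : nat, 2 / e <= K%:R.
  by exists (Num.bound (2 / e)); rewrite ltW// archi_boundP// divr_ge0// ltW.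
have [C hC] := EK K.
have K0 : 0 < K%:R :> R by rewrite (lt_le_trans _ eK)// divr_gt0.
near=> h.
have h0 : 0 < h%:R :> R by rewrite ltr0n; near: h; exact: nbhs_infty_gt.
rewrite ger0_norm ?divr_ge0 ?max_window_count_ge0// ler_pdivrMr//.
apply: ge_sup; first by exists (window_count E 0 h)%:R; exists 0.
move=> _ [a _ <-].
have hCh : C%:R <= h%:R :> R by rewrite ler_nat; near: h; exact: nbhs_infty_ge.
have := hC a h; rewrite -(ler_nat R) natrM natrD => wh.
have wK : K%:R * (window_count E a h)%:R <= 2 * h%:R :> R by lra.
have Ke : 2 <= K%:R * e by rewrite -ler_pdivrMr.
rewrite -(ler_pM2l K0); apply: (le_trans wK).
by rewrite mulrA ler_wpM2r// ltW.
Unshelve. all: by end_near. Qed.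

(** Otherwise, for each [a] in [E], [E - a] is almost disjoint from [E - b] for all far enough [b]
    in [E]. A greedy choice then yields arbitrarily many pairwise almost disjoint translates, which
    forces density zero. *)
Lemma exists_recurrent_difference (R : realType) (E : set int) :
  max_density R E <> 0 ->
  exists2 a : int, E a & forall B : nat, exists b : int, [/\ E b, (B <= `|b|)%N &
    forall B' : nat, exists m m' : int, [/\ E m, E m',
      (B' <= `|m|)%N, (B' <= `|m'|)%N & (a + m = b + m')%R]].
Proof.
move=> dE0; apply: contrapT => noa; apply: dE0; apply: max_density_eq0 => K.
have sep a : E a -> exists B : nat, forall b, E b -> (B <= `|b|)%N ->
    exists B', almost_disjoint E a b B'.
  move=> Ea; apply: contrapT => noB; apply: noa; exists a => // B.
  apply: contrapT => nob; apply: noB; exists B => b Eb Bb.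
  apply: contrapT => noB'; apply: nob; exists b; split => // B'.
  (* A common point [n] of the two translates beyond this bound gives [m = n + b] and [m' = n + a],
     both beyond [B']. *)
  apply: contrapT => nom; apply: noB'; exists (B' + `|a| + `|b|)%N => n Ea' Eb'.
  rewrite ltnNge; apply/negP => nB; apply: nom; exists (n + b), (n + a).
  by split => //; lia.
(* The greedy choice needs [E] unbounded; for a bounded [E] the window counts are bounded
   outright. *)
have [[G hG]|unb] := pselect (exists G : nat, forall m, E m -> (`|m| < G)%N).
  exists (K * G.*2)%N => a h; rewrite (leq_trans _ (leq_addl _ _))// leq_mul2l.
  by rewrite window_count_bounded ?orbT.
have [b Eb bd] : exists2 b : nat -> int, (forall i, (i < K)%N -> E (b i)) &
    forall i j, (i < j < K)%N -> exists B, almost_disjoint E (b i) (b j) B.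
  elim: K => [|K [b Eb bd]]; first by exists (fun=> 0) => // i j; rewrite ltn0 andbF.
  (* The next point is taken beyond the thresholds of all the earlier ones. *)
  have [G hG] : exists G, forall i, (i < K)%N -> forall c, E c -> (G <= `|c|)%N ->
      exists B, almost_disjoint E (b i) c B.
    apply: uniform_bound => [i B B' BB' h c Ec cB'|i iK].
      by apply: h => //; exact: leq_trans cB'.
    exact: sep (Eb i iK).
  have [c Ec cG] : exists2 c, E c & (G <= `|c|)%N.
    apply: contrapT => noc; apply: unb; exists G => m Em.
    by rewrite ltnNge; apply/negP => Gm; apply: noc; exists m.
  exists (fun i => if i == K then c else b i) => [i|i j /andP[ij]].
    by rewrite ltnS leq_eqVlt; case: eqP => //= _; exact: Eb.
  rewrite ltnS leq_eqVlt; case: (eqVneq j K) => /= [jK _|_ jK].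
    by rewrite jK in ij; rewrite (ltn_eqF ij); exact: hG.
  by rewrite (ltn_eqF (ltn_trans ij jK)); apply: bd; rewrite ij.
have [B hB] : exists B, forall j, (j < K)%N -> forall i, (i < j)%N ->
    almost_disjoint E (b i) (b j) B.
  apply: uniform_bound => [j B B' BB' h i ij n En En'|j jK].
    exact: leq_trans (h i ij n En En') BB'.
  apply: uniform_bound => [i B B' BB' h n En En'|i ij].
    exact: leq_trans (h n En En') BB'.
  by apply: bd; rewrite ij.
by apply: (@window_count_almost_disjoint E K b B) => i j /andP[ij jK]; exact: hB.
Qed.

(** * Seminorms on finite-dimensional spaces *)

Section seminorm.
Variables (R : realType) (V : lmodType R[i]).

(** The inequality for scalars implies equality, by applying it to the inverse of a nonzero [c]. *)
Definition seminorm (q : V -> R) :=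
  [/\ forall u, 0 <= q u, forall u v, q (u + v) <= q u + q v &
      forall c u, q (c *: u) <= normc c * q u].

(** The quotient seminorm modulo the line spanned by [e], pulled back to [V] so that the induction
    on the dimension stays in one space. *)
Definition quot_seminorm (q : V -> R) (e : V) (v : V) : R :=
  inf (range (fun t : R[i] => q (v - t *: e))).

Lemma has_inf_quot q e v : seminorm q ->
  has_inf (range (fun t : R[i] => q (v - t *: e))).
Proof.
move=> [q0 _ _]; split; first by exists (q (v - 0 *: e)), 0.
by exists 0 => _ [t _ <-].
Qed.

Lemma quot_seminorm_le q e v t : seminorm q -> quot_seminorm q e v <= q (v - t *: e).
Proof.
by move=> sq; apply: ge_inf; [case: (has_inf_quot e v sq)|exists t].
Qed.

Lemma quot_seminorm_lt q e v d : seminorm q -> quot_seminorm q e v < d ->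
  exists t, q (v - t *: e) < d.
Proof.
move=> sq lt; have d0 : 0 < d - quot_seminorm q e v by rewrite subr_gt0.
have [_ [t _ <-] vt] := inf_adherent d0 (has_inf_quot e v sq).
by exists t; apply: lt_le_trans vt _; rewrite -/(quot_seminorm _ _ _) addrC subrK.
Qed.

Lemma quot_seminormP q e : seminorm q -> seminorm (quot_seminorm q e).
Proof.
move=> sq; have [q0 qD qZ] := sq; split.
- move=> u; apply: lb_le_inf; first by case: (has_inf_quot e u sq).
  by move=> _ [t _ <-].
- move=> u v; apply/ler_addgt0Pr => d d0.
  have [|s us] := @quot_seminorm_lt q e u (quot_seminorm q e u + d / 2) sq.
    by rewrite ltrDl divr_gt0.
  have [|t vt] := @quot_seminorm_lt q e v (quot_seminorm q e v + d / 2) sq.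
    by rewrite ltrDl divr_gt0.
  apply: le_trans (quot_seminorm_le e (u + v) (s + t) sq) _.
  rewrite scalerDl opprD addrACA (le_trans (qD _ _))//; lra.
- move=> c u; have [->|c0] := eqVneq c 0.
    rewrite scale0r normc0 mul0r (le_trans (quot_seminorm_le e 0 0 sq))//.
    by rewrite scale0r subr0 -{1}(scale0r e) (le_trans (qZ _ _))// normc0 mul0r.
  have nc0 : 0 < normc c.
    by rewrite lt_neqAle normc_ge0 andbT eq_sym; apply: contra_neq c0 => /eq0_normc.
  rewrite mulrC -ler_pdivrMr//; apply: lb_le_inf; first by case: (has_inf_quot e u sq).
  move=> _ [t _ <-]; rewrite ler_pdivrMr// mulrC.
  apply: le_trans (quot_seminorm_le e (c *: u) (c * t) sq) _.
  by rewrite -scalerA -scalerBr.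
Qed.

Lemma seminorm_sum q (I : Type) (s : seq I) (F : I -> V) : seminorm q ->
  q (\sum_(i <- s) F i) <= \sum_(i <- s) q (F i).
Proof.
move=> [q0 qD qZ]; elim/big_ind2: _ => [|u x v y ux vy|//].
  by have := qZ 0 0; rewrite scale0r normc0 mul0r.
by rewrite (le_trans (qD _ _))// lerD.
Qed.

Lemma phase_exists (t : R[i]) : exists2 u : R[i], normc u = 1 & u * t = (normc t)%:C.
Proof.
have [->|t0] := eqVneq t 0; first by exists 1; rewrite ?normc1// mulr0 normc0.
have nt0 : normc t != 0 by apply: contra_neq t0 => /eq0_normc.
exists ((normc t)%:C / t); last by rewrite divfK.
by rewrite normcM normcV /= expr0n addr0 sqrtr_sqr ger0_norm ?normc_ge0// mulfV.
Qed.

(* On a space of dimension [n] one can choose the phases so that there is no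
   cancellation; by induction on [n], dividing out one generator at a time. *)
Lemma finite_dim_small_means (I : eqType) (P : I -> Prop) (n : nat) (q : V -> R)
    (e : 'I_n -> V) (w : I -> V) : seminorm q ->
  (forall i, P i -> exists c : 'I_n -> R[i], q (w i - \sum_(k < n) c k *: e k) = 0) ->
  (forall d : R, 0 < d -> exists K : nat, forall s : seq I, uniq s ->
    (forall i, i \in s -> P i) -> (K <= size s)%N ->
    forall u : I -> R[i], (forall i, normc (u i) = 1) ->
    q (\sum_(i <- s) u i *: w i) <= d * (size s)%:R) ->
  forall d : R, 0 < d -> exists K : nat, forall s : seq I, uniq s ->
    (forall i, i \in s -> P i /\ d < q (w i)) -> (size s < K)%N.
Proof.
elim: n q e => [|n IH] q e sq wspan wmean d d0; have [q0 qD qZ] := sq.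
  (* Without generators [q] vanishes on every [w i], so only the empty list qualifies. *)
  exists 1%N => -[//|i s] _ /(_ i (mem_head _ _))[Pi].
  by have [c] := wspan _ Pi; rewrite big_ord0 subr0 => ->; rewrite ltNge ltW.
have d80 : 0 < d / 8 by rewrite divr_gt0.
have d40 : 0 < d / 4 by rewrite divr_gt0.
(* Dividing out [e ord_max] bounds the number of indices whose quotient seminorm exceeds [d / 8]. *)
have {IH} [||K1 hK1] := IH (quot_seminorm q (e ord_max))
    (fun k => e (widen_ord (leqnSn n) k)) (quot_seminormP _ sq) _ _ (d / 8) d80.
- move=> i Pi; have [c] := wspan i Pi; rewrite big_ord_recr/= opprD addrA => c0.
  exists (fun k => c (widen_ord (leqnSn n) k)).
  apply/le_anti/andP; split; first by rewrite -c0 quot_seminorm_le.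
  by have [q'0 _ _] := quot_seminormP (e ord_max) sq; exact: q'0.
- move=> d' d'0; have [K hK] := wmean d' d'0; exists K => s us sP Ks u u1.
  rewrite -[X in quot_seminorm _ _ X]subr0 -(scale0r (e ord_max)).
  apply: le_trans (hK s us sP Ks u u1).
  rewrite (le_trans (quot_seminorm_le _ _ 0 sq))// scale0r !subr0//.
have [K0 hK0] := wmean _ d40.
(* At this length more than [K0] indices, those of [s2], have quotient seminorm at most [d / 8]:
   their [w i] are nearly multiples of the single vector [e ord_max]. *)
exists (K1 + K0.+1)%N => s us sP; rewrite ltnNge; apply/negP => sz.
pose a i := d / 8 < quot_seminorm q (e ord_max) (w i).
pose s1 := [seq i <- s | a i]; pose s2 := [seq i <- s | ~~ a i].
have s1K : (size s1 < K1)%N.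
  by apply: hK1 => [|i]; rewrite ?filter_uniq// mem_filter => /andP[ai /sP[]].
have s2K : (K0 < size s2)%N.
  have : size s = (size s1 + size s2)%N by rewrite !size_filter count_predC.
  by move: sz s1K; lia.
have s2P i : i \in s2 -> [/\ P i, d < q (w i) & ~~ a i].
  by rewrite mem_filter => /andP[ai /sP[]].
(* A coefficient [t] with [w i] within [d / 4] of [t *: e ord_max], and a phase [u] making [u * t]
   real and nonnegative. *)
pose good i (tu : R[i] * R[i]) := [/\ normc tu.2 = 1,
   i \in s2 -> q (w i - tu.1 *: e ord_max) < d / 4 & tu.2 * tu.1 = (normc tu.1)%:C].
have {}/boolp.choice[tu htu] i : exists tu, good i tu.
  rewrite /good; have [is2|is2] := boolP (i \in s2); last first.
    by exists (0, 1); split; [exact: normc1| |rewrite mulr0 normc0].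
  have [_ _] := s2P _ is2; rewrite -leNgt => ai.
  have [|t ht] := @quot_seminorm_lt q (e ord_max) (w i) (d / 4) sq; first by lra.
  by have [u u1 ut] := phase_exists t; exists (t, u).
pose t i := (tu i).1; pose u i := (tu i).2.
have big i : i \in s2 -> 3 / 4 * d <= normc (t i) * q (e ord_max).
  move=> is2; have [_ /(_ is2) h _] := htu i; have [_ wi _] := s2P _ is2.
  have := qD (w i - t i *: e ord_max) (t i *: e ord_max); rewrite subrK => h2.
  have := qZ (t i) (e ord_max); rewrite -/(t i) in h; lra.
pose N : R := (size s2)%:R.
have N0 : 0 < N by rewrite ltr0n (leq_trans _ s2K).
have sumc (c : R) : \sum_(i <- s2) c = N * c.
  by rewrite big_const_seq count_predT iter_addr_0 mulr_natl.
(* The phases prevent cancellation along [e ord_max]: the sum of the [(u i * t i) *: e ord_max] has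
   seminorm at least [3/4 * d * N] by [m3] and [m4], but at most [d/2 * N] by [m1] and [m2]. *)
have m1 : q (\sum_(i <- s2) u i *: w i) <= d / 4 * N.
  apply: hK0 => //; rewrite ?filter_uniq//; first by move=> i /s2P[].
  - exact: ltnW.
  - by move=> i; case: (htu i).
have m2 : q (\sum_(i <- s2) u i *: (w i - t i *: e ord_max)) <= d / 4 * N.
  rewrite (le_trans (seminorm_sum _ _ sq))// mulrC -sumc.
  rewrite big_seq [leRHS]big_seq; apply: ler_sum => i is2.
  have [u1 /(_ is2) h _] := htu i; rewrite (le_trans (qZ _ _))// u1 mul1r.
  exact: ltW.
pose S := \sum_(i <- s2) normc (t i).
have m3 : S * q (e ord_max) <= q (\sum_(i <- s2) (u i * t i) *: e ord_max).
  have S0 : 0 <= S by apply: sumr_ge0 => i _; exact: normc_ge0.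
  rewrite -scaler_suml (_ : \sum_(i <- s2) _ = S%:C); last first.
    by rewrite /S rmorph_sum; apply: eq_bigr => i _; case: (htu i).
  have [->|Sn0] := eqVneq S 0; first by rewrite mul0r.
  have := qZ (S%:C)^-1 (S%:C *: e ord_max).
  rewrite scalerA mulVf ?scale1r; last by apply: contra_neq Sn0 => /complexI.
  rewrite normcV/= expr0n addr0 sqrtr_sqr ger0_norm// ler_pdivlMl//.
  by rewrite lt_neqAle eq_sym Sn0.
have m4 : N * (3 / 4 * d) <= S * q (e ord_max).
  rewrite -sumc /S mulr_suml big_seq [leRHS]big_seq; apply: ler_sum => i is2.
  exact: big.
have m5 : q (\sum_(i <- s2) (u i * t i) *: e ord_max) <= d / 4 * N + d / 4 * N.
  rewrite (_ : \sum_(i <- s2) _ = \sum_(i <- s2) u i *: w i +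
     (-1) *: \sum_(i <- s2) u i *: (w i - t i *: e ord_max)); last first.
    rewrite scaleN1r -sumrN -big_split/=; apply: eq_bigr => i _.
    by rewrite scalerBr scalerA opprB addrCA subrr addr0.
  rewrite (le_trans (qD _ _))// lerD// (le_trans (qZ _ _))//.
  by rewrite normcN normc1 mul1r.
have : 0 < N * d by rewrite mulr_gt0.
by lra.
Qed.

End seminorm.

(** * Characters of the circle *)

Section fourier.
Variable R : realType.
Implicit Types (k : int) (t : R).

Definition cis (t : R) : R[i] := cos t +i* sin t.

Lemma cisD s t : cis (s + t) = cis s * cis t.
Proof.
rewrite /cis cosD sinD; apply/eqP; rewrite eq_complex /=.
by apply/andP; split; apply/eqP; ring.
Qed.

Lemma cis0 : cis 0 = 1.
Proof. by rewrite /cis cos0 sin0. Qed.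

Lemma cisX t (k : int) : cis t ^ k = cis (t * k%:~R).
Proof.
have cisXn n : cis t ^+ n = cis (t * n%:R).
  elim: n => [|n IH]; first by rewrite mulr0 cis0.
  by rewrite exprS IH -cisD mulrS mulrDr mulr1.
case: k => n; first exact: cisXn.
rewrite NegzE -exprnN cisXn -[RHS]mul1r; apply: (mulIf (x := cis (t * n.+1%:R))).
  apply/eqP => c0; have := cisD (t * n.+1%:R) (- (t * n.+1%:R)).
  by rewrite c0 mul0r subrr cis0 => /eqP; rewrite oner_eq0.
rewrite mulVf; last first.
  apply/eqP => c0; have := cisD (t * n.+1%:R) (- (t * n.+1%:R)).
  by rewrite c0 mul0r subrr cis0 => /eqP; rewrite oner_eq0.
by rewrite mul1r -cisD mulrNz mulrN addNr cis0.
Qed.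

Lemma cis_2pi_int k : cis (2 * pi * k%:~R) = 1.
Proof. by rewrite -cisX /cis mulr_natl cos2pi sin2pi exp1rz. Qed.

Lemma integral_derivative (f F : R -> R) : continuous f ->
  (forall t, is_derive t 1 F (f t)) ->
  (\int[lebesgue_measure]_(t in `[0%R, 1%R]) (f t)%:E = (F 1 - F 0)%:E)%E.
Proof.
move=> cf dF; have cF : continuous F.
  by move=> x; apply/differentiable_continuous/derivable1_diffP; case: (dF x).
rewrite (@continuous_FTC2 _ _ F)//.
- exact: continuous_subspaceT.
- split; first by move=> x _; case: (dF x).
    by apply: cvg_at_right_filter; exact: cF.
  by apply: cvg_at_left_filter; exact: cF.
- by move=> x _; rewrite derive1E; apply: derive_val.
Qed.

(** The added 1 makes the integrand nonnegative, as [ge0_integral_haar] requires; [Rintegral_haar0]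
    removes it afterwards. *)
Lemma integral_cos (c : R) : c != 0 -> cis c = 1 ->
  (\int[lebesgue_measure]_(t in `[0%R, 1%R]) (1 + cos (c * t))%:E = 1)%E.
Proof.
move=> c0 [_ s0].
have cf : continuous (fun t : R => 1 + cos (c * t)).
  move=> x; apply: continuousD; first exact: cvg_cst.
  by apply: continuous_comp; [exact: mulrl_continuous|exact: continuous_cos].
have dF (t : R) : is_derive t 1 (fun t : R => t + c^-1 * sin (c * t)) (1 + cos (c * t)).
  apply: is_derive_eq; rewrite /= /GRing.scale/= mulr1 (mulrC _ c).
  by rewrite mulKf.
rewrite (integral_derivative cf dF).
by rewrite !mulr1 !mulr0 sin0 s0 mulr0 !addr0 subr0.
Qed.

Lemma integral_sin (c : R) : c != 0 -> cis c = 1 ->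
  (\int[lebesgue_measure]_(t in `[0%R, 1%R]) (1 + sin (c * t))%:E = 1)%E.
Proof.
move=> c0 [c1 _].
have cf : continuous (fun t : R => 1 + sin (c * t)).
  move=> x; apply: continuousD; first exact: cvg_cst.
  by apply: continuous_comp; [exact: mulrl_continuous|exact: continuous_sin].
have dF (t : R) : is_derive t 1 (fun t : R => t - c^-1 * cos (c * t)) (1 + sin (c * t)).
  apply: is_derive_eq; rewrite /= /GRing.scale/= mulr1 (mulrC _ c).
  by rewrite mulKf// opprK.
rewrite (integral_derivative cf dF).
by rewrite !mulr1 !mulr0 cos0 c1 sub0r opprK subrK.
Qed.

Lemma circle_val_cis t (k : int) :
  circle_val (circle_exp t) ^ k = cis (2 * pi * k%:~R * t).
Proof. by rewrite -[circle_val _]/(cis (2 * pi * t)) cisX mulrAC. Qed.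

Lemma ge0_integral_haar (f : circle R -> R) :
  measurable_fun setT f -> (forall z, 0 <= f z) ->
  (\int[haar R]_z (f z)%:E =
   \int[lebesgue_measure]_(t in `[0%R, 1%R]) (f (circle_exp t))%:E)%E.
Proof.
move=> mf f0; rewrite ge0_integral_distribution//; last exact/measurable_EFinP.
rewrite integral_uniform ?subr0 ?invr1 ?mul1e//.
  apply/measurable_EFinP; apply: measurableT_comp => //.
by move=> x; rewrite /= lee_fin.
Qed.

Lemma fine_haar_setT : fine (haar R [set: circle R]) = 1.
Proof. exact: congr1 (@probability_setT _ _ _ (haar R)). Qed.

Lemma integrable_bounded_haar (f : circle R -> R) (M : R) :
  measurable_fun setT f -> (forall z, `|f z| <= M) ->
  (haar R).-integrable setT (EFin \o f).
Proof.
move=> mf fM; apply: (@le_integrable _ _ _ _ _ measurableT _ (EFin \o cst M)).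
- exact/measurable_EFinP.
- by move=> z _ /=; rewrite lee_fin (le_trans (fM z))// ler_norm.
- exact: finite_measure_integrable_cst.
Qed.

Lemma Rintegral_haar0 (f : circle R -> R) :
  measurable_fun setT f -> (forall z, `|f z| <= 1) ->
  (\int[haar R]_z (1 + f z)%:E = 1)%E -> \int[haar R]_z f z = 0.
Proof.
move=> mf f1 I1; have intf := integrable_bounded_haar mf f1.
have : \int[haar R]_z (1 + f z) = 1 by rewrite /Rintegral I1.
rewrite RintegralD//; last exact: finite_measure_integrable_cst.
by rewrite Rintegral_cst// fine_haar_setT mul1r -[RHS]addr0 => /addrI.
Qed.

Lemma cintegral_circleX (k : int) :
  cintegral (haar R) (fun z => circle_val z ^ k) = (k == 0)%:R.
Proof.
have [->|k0] := eqVneq k 0.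
  rewrite /cintegral; under eq_Rintegral do rewrite expr0z.
  under [X in _ +i* X]eq_Rintegral do rewrite expr0z.
  by rewrite /= !Rintegral_cst// fine_haar_setT mulr1 mul0r.
have c0 : 2 * pi * k%:~R != 0 :> R.
  by rewrite !mulf_neq0 ?intr_eq0// gt_eqF// pi_gt0.
have [mR mI] := cmeasurable_circleX R k.
have leR (z : circle R) : `|complex.Re (circle_val z ^ k)| <= 1.
  by rewrite (le_trans (Re_le_normc _))// normc_circleX.
have leI (z : circle R) : `|complex.Im (circle_val z ^ k)| <= 1.
  by rewrite (le_trans (Im_le_normc _))// normc_circleX.
have ge0 (x : R) : `|x| <= 1 -> 0 <= 1 + x by rewrite ler_norml => /andP[]; lra.
have c1 := cis_2pi_int k.
rewrite /cintegral !(@Rintegral_haar0 _)//.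
- rewrite ge0_integral_haar; [|exact: measurable_funD|by move=> z; exact: ge0].
  by under eq_integral do rewrite circle_val_cis; exact: integral_sin.
- rewrite ge0_integral_haar; [|exact: measurable_funD|by move=> z; exact: ge0].
  by under eq_integral do rewrite circle_val_cis; exact: integral_cos.
Qed.

End fourier.

(** * Trigonometric polynomials and their [L^p] norms *)

Section trigonometric.
Variable R : realType.

Lemma circle_val_neq0 (z : circle R) : circle_val z != 0.
Proof.
apply: contraTneq (oner_neq0 R) => z0.
by rewrite -(normc_circle z) z0 normc0 eqxx.
Qed.

(** Terms are indexed by [J] and not by frequency, so that frequencies may repeat, as they do in
    expanded powers. *)
Definition trig (J : Type) (s : seq J) (c : J -> R[i]) (x : J -> int)
  (z : circle R) : R[i] := \sum_(j <- s) c j * circle_val z ^ (x j).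

Section cLfun.
Variables (p : R) (p1 : 1 <= p).

Lemma cLnorm_circleX (k : int) :
  cLnorm (haar R) p (fun z => circle_val z ^ k) = 1%E.
Proof.
rewrite /cLnorm unlock /=.
under eq_integral do rewrite normc_circleX normr1 powR1.
rewrite integral_cst// [X in (_ * X)%E](_ : _ = 1%E) ?mule1 ?poweR1r//.
exact: probability_setT.
Qed.

Lemma circleX_cLfun (k : int) :
  (fun z : circle R => circle_val z ^ k) \in cLfun (haar R) p.
Proof.
rewrite inE /=; split; first exact: cmeasurable_circleX.
by rewrite cLnorm_circleX ltry.
Qed.

Definition char_fun (k : int) : cLfunType (haar R) p1 := CLfun p1 (circleX_cLfun k).

Definition char_Lp (k : int) : cLp (haar R) p1 := \pi_(cLp (haar R) p1) (char_fun k).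

Variables (J : Type) (c : J -> R[i]) (x : J -> int).

Definition trig_fun (s : seq J) : cLfunType (haar R) p1 :=
  \sum_(j <- s) c j *: char_fun (x j).

Lemma trig_funE s : trig_fun s = trig s c x :> (circle R -> R[i]).
Proof.
apply/funext => z; rewrite /trig_fun /trig.
by elim/big_rec2: _ => // j u v _ <-.
Qed.

Lemma trig_Lp s :
  \sum_(j <- s) c j *: char_Lp (x j) = \pi_(cLp (haar R) p1) (trig_fun s).
Proof.
rewrite /trig_fun; elim/big_rec2: _ => // j u v _ ->.
rewrite -[LHS]/(cLp_add _ _) -[_ *: char_Lp _]/(cLp_scale _ _).
by rewrite pi_cLp_scale pi_cLp_add.
Qed.

End cLfun.

Lemma cmeasurable_trig J (s : seq J) c x : cmeasurable (trig s c x).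
Proof. by rewrite -(trig_funE (lexx (1 : R))); exact: cLfun_meas. Qed.

Lemma cintegral_trig J (s : seq J) c x :
  cintegral (haar R) (trig s c x) = \sum_(j <- s) c j * (x j == 0)%:R.
Proof.
rewrite -(trig_funE (lexx (1 : R))) /trig_fun; elim: s => [|j s IH].
  have I0 : \int[haar R]_z (0 : R) = 0 by rewrite Rintegral_cst// mul0r.
  by rewrite !big_nil; exact: (congr2 (@Complex R) I0 I0).
rewrite !big_cons -IH -cintegral_circleX.
set f := char_fun _ _; set g := \sum_(j <- s) _.
have w1 (z : circle R) : normc (1 : R[i]) = 1 by exact: normc1.
have mw : cmeasurable (fun _ : circle R => 1 : R[i]) by split; exact: measurable_cst.
have := cintegral_lin (lexx 1) (c j) (cLfunP f) (cLfunP g) mw w1.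
have E (h : circle R -> R[i]) : (fun z => h z * 1) = h.
  by apply/funext => z; rewrite mulr1.
by rewrite !E.
Qed.

Section norm.
Variables (p : nat) (p1 : 1 <= p%:R :> R).

(** The norm lives in [R[i]]; the real witness [r] lets its [p]-th power be compared with an
    integral. *)
Lemma norm_trig J (s : seq J) (c : J -> R[i]) (x : J -> int) :
  exists2 r : R, 0 <= r & `|\sum_(j <- s) c j *: char_Lp p1 (x j)| = r%:C /\
    ((r ^+ p)%:E = \int[haar R]_z (normc (trig s c x z) ^+ p)%:E)%E.
Proof.
exists (fine (cLnorm (haar R) p%:R (trig s c x))).
  by rewrite fine_ge0 // Lnorm_ge0.
split; first by rewrite trig_Lp -[LHS]/(cLp_norm _) cLp_norm_pi trig_funE.
have p0 : p%:R != 0 :> R by rewrite gt_eqF// (lt_le_trans _ p1).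
rewrite -powR_mulrn; last by rewrite fine_ge0 // Lnorm_ge0.
rewrite -poweR_EFin -(trig_funE p1) cLfun_finite poweR_Lnorm// trig_funE.
apply: eq_integral => z _ /=; rewrite ger0_norm ?normc_ge0//.
by rewrite powR_mulrn ?normc_ge0.
Qed.

End norm.

(* Frequency of the monomial of [trig ^+ n] selected by [phi]. *)
Definition freq (J : finType) (x : J -> int) n (phi : {ffun 'I_n -> J}) : int :=
  \sum_i x (phi i).

(** The sum runs over words of length [n], so no multinomial coefficients appear. *)
Lemma trigX (J : finType) (c : J -> R[i]) (x : J -> int) n z :
  trig (enum J) c x z ^+ n =
  \sum_(phi : {ffun 'I_n -> J}) (\prod_i c (phi i)) * circle_val z ^ freq x phi.
Proof.
rewrite /trig big_enum /= -[n in LHS]card_ord -prodr_const bigA_distr_bigA/=.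
apply: eq_bigr => phi _; rewrite big_split/=; congr (_ * _).
symmetry; apply: (big_morph _ _ (expr0z (circle_val z))) => a b.
apply: expfzDr; exact: circle_val_neq0.
Qed.

End trigonometric.

(** * Moments of trigonometric polynomials *)

Section moments.
Variable R : realType.

Lemma conjc_circleX (z : circle R) (k : int) :
  conjc (circle_val z ^ k) = circle_val z ^ (- k).
Proof.
have z1 := normc_circleX k z.
have z0 : circle_val z ^ k != 0 by rewrite expfz_neq0 ?circle_val_neq0.
rewrite -[circle_val z ^ (- k)]mul1r -invr_expz; apply: (canRL (mulfK _)) => //.
rewrite mulrC -[RHS](_ : (normc (circle_val z ^ k) ^+ 2)%:C = _); last first.
  by rewrite z1 expr1n.
case: (circle_val z ^ k) => a b; apply/eqP; rewrite eq_complex /=.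
by rewrite sqr_sqrtr ?addr_ge0 ?sqr_ge0//; apply/andP; split; apply/eqP; ring.
Qed.

Lemma Re_mul_conjc (w : R[i]) : complex.Re (w * conjc w) = normc w ^+ 2.
Proof.
by case: w => a b; rewrite /= sqr_sqrtr ?addr_ge0 ?sqr_ge0//; ring.
Qed.

(** Parseval with repeated frequencies: the squared modulus is a trigonometric polynomial indexed by
    pairs, and only pairs of equal frequency survive integration. *)
Lemma integral_trig_sqr J (s : seq J) (c : J -> R[i]) (x : J -> int) :
  (\int[haar R]_z (normc (trig s c x z) ^+ 2)%:E =
   (complex.Re (\sum_(i <- s) \sum_(j <- s) c i * conjc (c j) * (x i == x j)%:R))%:E)%E.
Proof.
pose s2 := [seq (i, j) | i <- s, j <- s].
pose c2 (ij : J * J) := c ij.1 * conjc (c ij.2).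
pose x2 (ij : J * J) := x ij.1 - x ij.2.
have E z : trig s c x z * conjc (trig s c x z) = trig s2 c2 x2 z.
  rewrite /trig /s2 big_allpairs rmorph_sum mulr_suml; apply: eq_bigr => i _.
  rewrite mulr_sumr; apply: eq_bigr => j _.
  rewrite rmorphM/= conjc_circleX mulrACA /c2 /x2/= expfzDr//.
  exact: circle_val_neq0.
under eq_integral do rewrite -Re_mul_conjc E.
(* The weight [z ^ 0 = 1] gives integrability, so that passing through [fine] loses nothing. *)
have [+ _] := cLfun_integrable (lexx 1) (cLfunP (trig_fun (lexx (1 : R)) c2 x2 s2))
  (cmeasurable_circleX R 0) (normc_circleX 0).
rewrite trig_funE (_ : (fun z => complex.Re _) =
   (fun z => complex.Re (trig s2 c2 x2 z))); last first.
  by apply/funext => z; rewrite expr0z mulr1.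
move=> int2; rewrite -[LHS]fineK; last exact: integrable_fin_num int2.
congr EFin; rewrite -[LHS]/(complex.Re (cintegral (haar R) (trig s2 c2 x2))).
rewrite cintegral_trig big_allpairs; congr complex.Re.
by apply: eq_bigr => i _; apply: eq_bigr => j _; rewrite subr_eq0.
Qed.

(** Parseval applied to the [n]-th power, whose terms are indexed by words. *)
Lemma integral_trig_even (J : finType) (e : J -> R) (x : J -> int) n :
  (\int[haar R]_z (normc (trig (enum J) (fun j => (e j)%:C) x z) ^+ n.*2)%:E =
   (\sum_(phi : {ffun 'I_n -> J}) \sum_(psi : {ffun 'I_n -> J})
     (\prod_i e (phi i)) * (\prod_i e (psi i)) * (freq x phi == freq x psi)%:R)%:E)%E.
Proof.
pose c (phi : {ffun 'I_n -> J}) : R[i] := (\prod_i e (phi i))%:C.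
have E z : trig (enum J) (fun j => (e j)%:C) x z ^+ n =
    trig (enum {ffun 'I_n -> J}) c (@freq J x n) z.
  rewrite trigX /trig big_enum; apply: eq_bigr => phi _; congr (_ * _).
  by rewrite /c rmorph_prod.
under eq_integral do rewrite -mul2n mulnC exprM -normcX E.
rewrite integral_trig_sqr; congr EFin.
rewrite -[RHS]/(complex.Re (_%:C)) rmorph_sum big_enum/=; congr complex.Re.
apply: eq_bigr => phi _; rewrite rmorph_sum big_enum; apply: eq_bigr => psi _.
by rewrite oppr0 !rmorphM rmorph_nat.
Qed.

(** No signed term exceeds the unsigned one, and the pair [(phi0, psi0)] goes from -1 to 1. *)
Lemma moment_gap (J : finType) (e : J -> R) (x : J -> int) n
    (phi0 psi0 : {ffun 'I_n -> J}) :
  (forall j, `|e j| = 1) -> freq x phi0 = freq x psi0 ->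
  (\prod_i e (phi0 i)) * (\prod_i e (psi0 i)) = -1 ->
  \sum_(phi : {ffun 'I_n -> J}) \sum_(psi : {ffun 'I_n -> J})
     (\prod_i e (phi i)) * (\prod_i e (psi i)) * (freq x phi == freq x psi)%:R + 2 <=
  \sum_(phi : {ffun 'I_n -> J}) \sum_(psi : {ffun 'I_n -> J})
     (\prod_(i < n) 1) * (\prod_(i < n) 1) * (freq x phi == freq x psi)%:R.
Proof.
move=> e1 eqf em1.
have le1 (phi psi : {ffun 'I_n -> J}) :
    (\prod_i e (phi i)) * (\prod_i e (psi i)) * (freq x phi == freq x psi)%:R
    <= (\prod_(i < n) 1) * (\prod_(i < n) 1) * (freq x phi == freq x psi)%:R :> R.
  rewrite ler_wpM2r// !big1_eq mulr1 (le_trans (ler_norm _))// normrM !normr_prod.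
  by rewrite !big1// mulr1.
rewrite (bigD1 phi0)//= [leRHS](bigD1 phi0)//= addrAC lerD//; last first.
  by apply: ler_sum => phi _; apply: ler_sum => psi _; exact: le1.
rewrite (bigD1 psi0)//= [leRHS](bigD1 psi0)//= addrAC lerD//; last first.
  by apply: ler_sum => psi _; exact: le1.
by rewrite em1 eqf eqxx !big1_eq !mulr1; lra.
Qed.

(** For [N] characters the sum is bounded by [N] and has square integral [N], so its [p]-th moment
    is at most [N^(p-2) * N]. Hence its norm is [o(N)]. *)
Lemma norm_char_Lp_mean (p : nat) (p1 : 1 <= p%:R :> R) (s : seq int)
    (u : int -> R[i]) (r : R) : (1 < p)%N -> uniq s -> (forall m, normc (u m) = 1) ->
  `|\sum_(m <- s) u m *: char_Lp p1 m| = r%:C -> r ^+ p <= (size s)%:R ^+ p.-1.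
Proof.
move=> p2 us u1; have [r' r0 [-> rp]] := norm_trig p1 s u id.
move=> /complexI <-; rewrite -lee_fin rp; set N : R := (size s)%:R.
have mt := cmeasurable_normc (cmeasurable_trig s u id).
have tN z : normc (trig s u id z) <= N.
  apply: (@le_trans _ _ (\sum_(m <- s) 1)); last first.
    by rewrite big_const_seq count_predT iter_addr_0.
  rewrite /trig; elim/big_rec2: _ => [|m a b _ ab]; first by rewrite normc0.
  by rewrite (le_trans (le_normcD _ _))// lerD// normcM u1 normc_circleX mulr1.
apply: (@le_trans _ _ (\int[haar R]_z ((N ^+ p.-2)%:E * (normc (trig s u id z) ^+ 2)%:E))%E).
  apply: ge0_le_integral => //.
  - by move=> z _; rewrite lee_fin exprn_ge0// normc_ge0.
  - by apply/measurable_EFinP; exact: measurable_funX.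
  - apply: measurable_funeM; apply/measurable_EFinP; exact: measurable_funX.
  - move=> z _; rewrite -EFinM lee_fin -[in leLHS](subnK p2) exprD subn2.
    by rewrite ler_wpM2r// ?exprn_ge0 ?normc_ge0// lerXn2r ?nnegrE ?normc_ge0.
rewrite ge0_integralZl_EFin//; last 3 first.
- by move=> z _; rewrite lee_fin exprn_ge0// normc_ge0.
- by apply/measurable_EFinP; exact: measurable_funX.
- by rewrite exprn_ge0.
rewrite integral_trig_sqr -EFinM lee_fin.
rewrite (_ : \sum_(i <- s) _ = N%:C).
  by rewrite /= -exprSr prednK// -subn1 subn_gt0.
rewrite (_ : N%:C = \sum_(i <- s) 1); last first.
  by rewrite big_const_seq count_predT iter_addr_0 rmorph_nat.
rewrite big_seq [RHS]big_seq; apply: eq_bigr => i is_.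
rewrite (bigD1_seq i)//= eqxx mulr1 big1 ?addr0; last first.
  by move=> j ji; rewrite eq_sym (negbTE ji) mulr0.
have := Re_mul_conjc (u i); rewrite u1 expr1n.
by case: (u i) => a b; simpc => /= ->; rewrite mulrC addNr.
Qed.

End moments.

(** * Finite rank operators and real umap *)

Section LpE_characters.
Variables (R : realType) (E : set int) (p : nat) (p1 : 1 <= p%:R :> R).

Lemma char_Lp_LpE m : E m -> char_Lp p1 m \in @LpE_pred R E p%:R p1.
Proof.
move=> Em; rewrite inE /= => n En; rewrite fourier_coef_pi /fourier_coef /=.
rewrite (_ : (fun z => _) = (fun z : circle R => circle_val z ^ (m - n))).
  by rewrite cintegral_circleX subr_eq0; case: eqP => // mn; rewrite mn in Em.
apply/funext => z; rewrite expfzDr//; exact: circle_val_neq0.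
Qed.

(* The junk value [0] off [E] makes this a total function. *)
Definition char_LpE (m : int) : LpE E p1 :=
  if pselect (E m) is left Em
  then @Build_LpE R E p%:R p1 (char_Lp p1 m) (char_Lp_LpE Em) else 0.

Lemma norm_sum_char_LpE (J : eqType) (s : seq J) (c : J -> R[i]) (x : J -> int) :
  (forall j, j \in s -> E (x j)) ->
  `|\sum_(j <- s) c j *: char_LpE (x j)| = `|\sum_(j <- s) c j *: char_Lp p1 (x j)|.
Proof.
move=> sE; rewrite -[LHS]/(`|LpE_val _|); congr (`|_|).
rewrite (big_morph (@LpE_val R E p%:R p1) (id1 := 0) (op1 := +%R))//.
rewrite big_seq [RHS]big_seq; apply: eq_bigr => j js.
rewrite -[LHS]/(c j *: LpE_val _); congr (_ *: _).
by rewrite /char_LpE; case: pselect => // /(_ (sE j js)).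
Qed.

(** The norm as an element of [R], where [lra] applies. *)
Definition rnorm (u : LpE E p1) : R := complex.Re `|u|.

Lemma rnormE u : `|u| = (rnorm u)%:C.
Proof. by []. Qed.

Lemma seminorm_rnorm : seminorm rnorm.
Proof.
split.
- by move=> u; rewrite -lecR; exact: (normr_ge0 u).
- by move=> u v; rewrite -lecR rmorphD/= -!rnormE ler_normD.
- by move=> c u; rewrite -lecR rmorphM/= -!rnormE normrZ.
Qed.

(** [M] is only given in [R[i]], but [M * |u|] dominates a norm, hence equals its own modulus. *)
Lemma rnorm_bounded (f : LpE E p1 -> LpE E p1) (M : R[i]) u :
  opnorm_le f M -> rnorm (f u) <= normc M * rnorm u.
Proof.
move=> fM; rewrite -lecR rmorphM/= -!rnormE -[(normc M)%:C]/(`|M|).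
rewrite -[X in _ * X]normr_id -normrM (le_trans (fM u))// ger0_norm//.
exact: le_trans (fM u).
Qed.

(** [T] maps sums of [N] unimodular multiples of characters to vectors of norm [o(N)], so by
    [finite_dim_small_means] only finitely many characters have an image of norm above [d]. *)
Lemma linear_finite_rank_char_small (T : {linear LpE E p1 -> LpE E p1}) (d : R) :
  (1 < p)%N -> (exists M, opnorm_le T M) -> finite_rank T -> 0 < d ->
  exists B : nat, forall m, E m -> (B <= `|m|)%N -> rnorm (T (char_LpE m)) <= d.
Proof.
move=> p2 [M TM] [n [e Te]] d0.
have [||K hK] := @finite_dim_small_means R _ int E n rnorm e (fun m => T (char_LpE m))
    seminorm_rnorm _ _ d d0.
- move=> m _; have [c Tc] := Te (char_LpE m); exists c.
  by rewrite Tc subrr /rnorm normr0.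
(* For [N >= A], [|M|^p * N^(p-1)] is at most [d'^p * N^p]. *)
- move=> d' d'0; pose A := normc M ^+ p / d' ^+ p.
  have A0 : 0 <= A by rewrite divr_ge0// exprn_ge0 ?normc_ge0// ltW.
  exists (Num.bound A) => s us sE sK u u1.
  rewrite (_ : \sum_(i <- s) _ = T (\sum_(i <- s) u i *: char_LpE i)); last first.
    by rewrite linear_sum; apply: eq_bigr => i _; rewrite linearZ.
  apply: (le_trans (rnorm_bounded _ TM)).
  set v := \sum_(i <- s) _.
  have vs : rnorm v ^+ p <= (size s)%:R ^+ p.-1.
    apply: (norm_char_Lp_mean p2 us u1).
    by rewrite -norm_sum_char_LpE// -rnormE.
  have p0 : (0 < p)%N by exact: ltnW.
  have v0 : 0 <= rnorm v by case: seminorm_rnorm.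
  rewrite -(@ler_pXn2r _ p)// ?nnegrE ?mulr_ge0 ?normc_ge0 ?(ltW d'0)//.
  rewrite !exprMn. apply: (@le_trans _ _ (normc M ^+ p * (size s)%:R ^+ p.-1)).
    by rewrite ler_wpM2l// exprn_ge0// normc_ge0.
  rewrite -[in leRHS](prednK p0) [_%:R ^+ _.+1]exprS prednK// mulrA ler_wpM2r ?exprn_ge0//.
  rewrite mulrC -ler_pdivrMr ?exprn_gt0// ltW// (lt_le_trans (archi_boundP A0))//.
  by rewrite ler_nat.
apply: contrapT => noB.
have big B : exists m : int, [/\ E m, (B <= `|m|)%N & d < rnorm (T (char_LpE m))].
  apply: contrapT => nom; apply: noB; exists B => m Em Bm.
  by rewrite leNgt; apply/negP => dm; apply: nom; exists m.
have [s [us sz sd]] : exists s : seq int, [/\ uniq s, size s = K &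
    forall m, m \in s -> E m /\ d < rnorm (T (char_LpE m))].
  elim: (K) => [|k [s [us sz sd]]]; first by exists [::].
  (* Exceeding every absolute value in [s] keeps the list duplicate-free. *)
  have [m [Em sm dm]] := big (\max_(j <- s) `|j|).+1%N.
  exists (m :: s); split => [/=||j]; last 1 first.
  - by rewrite inE => /orP[/eqP->//|/sd].
  - rewrite us andbT; apply/negP => ms; move: sm; rewrite ltnNge => /negP; apply.
    by rewrite (big_rem m)//= leq_maxl.
  - by rewrite /= sz.
by have := hK s us sd; rewrite sz ltnn.
Qed.

End LpE_characters.

(** Both [A] and [B] lie in [[0, 5]], where [x^n] is Lipschitz; the 4 is the triangle bound for four
    characters. *)
Lemma exprD_le (R : realFieldType) (A B d : R) n : 0 <= A -> 0 <= B -> B <= 4 ->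
  0 <= d -> d <= 1 -> A <= B + d -> A ^+ n <= B ^+ n + d * n%:R * 5 ^+ n.
Proof.
move=> A0 B0 B4 d0 d1 AB; elim: n => [|n IH]; first by rewrite mulr0 mul0r addr0.
have F1 : 1 <= 5 ^+ n :> R by rewrite exprn_ege1//; lra.
have Bn : B ^+ n <= 5 ^+ n by rewrite lerXn2r ?nnegrE//; lra.
rewrite !exprS; set a := A ^+ n in IH *; set b := B ^+ n in IH Bn *.
set F := 5 ^+ n in IH F1 Bn *.
have b0 : 0 <= b by rewrite exprn_ge0.
have dF0 : 0 <= d * n%:R * F by rewrite !mulr_ge0//; lra.
have := ler_pM A0 (exprn_ge0 n A0) AB IH; rewrite -/a => /le_trans; apply.
have h1 : d * b <= d * F by rewrite ler_wpM2l.
have h2 : (B + d) * (d * n%:R * F) <= 5 * (d * n%:R * F) by rewrite ler_wpM2r//; lra.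
have h3 : 0 <= d * F by rewrite mulr_ge0//; lra.
rewrite -natr1; nra.
Qed.

Lemma rnorm_char_LpE (R : realType) (E : set int) (p : nat) (p1 : 1 <= p%:R :> R) m :
  E m -> rnorm (char_LpE E p1 m) = 1.
Proof.
move=> Em; have := @norm_sum_char_LpE R E p p1 _ [:: m] (fun=> 1) id.
rewrite !big_seq1 !scale1r /rnorm => ->; last by move=> j; rewrite inE => /eqP->.
rewrite -[LHS]/(complex.Re (cLp_norm _)) cLp_norm_pi /= cLnorm_circleX//.
Qed.

(** With [u k = T k y], switching the sign after [N] produces [2 T_N y - T_n y], which approximates
    [(2 T_N - I) y] for large [n]. *)
Lemma sum_sign_telescope (K : nzRingType) (V : lmodType K) (u : nat -> V) N n :
  u 0%N = 0 -> (N <= n)%N ->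
  \sum_(1 <= k < n.+1) (if (k <= N)%N then 1 else -1) *: (u k - u k.-1) =
  u N - (u n - u N).
Proof.
move=> u0 Nn.
have lo k : (k <= N)%N -> \sum_(1 <= j < k.+1)
    (if (j <= N)%N then 1 else -1) *: (u j - u j.-1) = u k.
  elim: k => [|k IH] kN; first by rewrite big_geq.
  by rewrite big_nat_recr//= IH ?(ltnW kN)// kN scale1r addrC subrK.
rewrite -(subnKC Nn); elim: (n - N)%N => [|k IH].
  by rewrite addn0 lo// subrr subr0.
rewrite addnS big_nat_recr//= IH leqNgt ltnS leq_addr /= scaleN1r.
by rewrite !opprB -addrA; congr (_ + _); rewrite addrA subrK.
Qed.

(** Since [T f] is near [f], [2T - I] sends [f - g] near [f + g - 2 T g], and umap bounds it by
    almost 1. *)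
Lemma real_umap_reflection (R : realType) (E : set int) (p : nat)
    (p1 : 1 <= p%:R :> R) (f : LpE E p1) (eps : R) :
  real_umap (LpE E p1) -> 0 < eps ->
  exists T : {linear LpE E p1 -> LpE E p1},
    [/\ exists M, opnorm_le T M, finite_rank T, rnorm (f - T f) < eps &
      forall g, rnorm (f + g) <=
        (1 + eps) * rnorm (f - g) + 3 * eps + 2 * rnorm (T g)].
Proof.
move=> umap eps0.
have [|T [T0 Tfin Tcvg Tle]] := umap eps%:C; first by rewrite ltcR.
have cvgT y : \forall k \near \oo, rnorm (y - T k y) < eps.
  have /cvgrPdist_lt/(_ eps%:C) := Tcvg y; rewrite ltcR => /(_ eps0).
  by apply: filterS => k; rewrite rnormE ltcR.
have [N _ hN] := cvgT f; have [M TNfin] := Tfin N.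
exists (T N); split=> // [|g]; first exact: hN (leqnn N).
(* [N] was fixed before [g], so [T N] serves every [g]; only [n'] depends on [g]. *)
have [n _ hn] := cvgT (f - g); pose n' := maxn N n.
have := hn n' (leq_maxr _ _); have := hN N (leqnn N).
pose e k : R[i] := if (k <= N)%N then 1 else -1.
have sgn k : e k = 1 \/ e k = -1 by rewrite /e; case: ifP; [left|right].
have := Tle n' _ sgn (f - g).
rewrite (@sum_sign_telescope _ _ (fun k => T k (f - g)) N n' (T0 _) (leq_maxl N n)).
rewrite !rnormE (_ : 1 + eps%:C = (1 + eps)%:C) -?rmorphM/= ?lecR; last first.
  by rewrite rmorphD.
move=> h1 h2 h3.
have [q0 qD qZ] := seminorm_rnorm E p1.
set w := f - g - _ in h3; set s := T N (f - g) in h1; set v := s - _ in h1.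
(* Here [v - w = 2 T(f - g) - (f - g)]. The term [w] costs [eps] and [2 *: (f - T N f)] costs
   [2 * eps]. *)
have -> : f + g = (v + (-1) *: w) + (2 *: (f - T N f) + 2 *: T N g).
  rewrite scaleN1r -scalerDr scaler_nat mulr2n.
  have -> : f - T N f + T N g = f - s by rewrite /s linearB opprB addrA addrAC.
  have -> : v - w = s + (s - (f - g)).
    by rewrite /v /w !opprB -!addrA; congr (_ + (_ + _)); rewrite addrA addNr add0r.
  rewrite addrACA [s + (f - s)]addrC subrK; congr (_ + _).
  by rewrite addrC addrA subrK opprB addrC subrK.
have q2 (u : LpE E p1) : rnorm (2 *: u) <= 2 * rnorm u.
  by apply: le_trans (qZ 2 u) _; rewrite normcMn normc1.
have qN (u : LpE E p1) : rnorm ((-1) *: u) <= rnorm u.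
  by apply: le_trans (qZ _ u) _; rewrite normcN normc1 mul1r.
have := qD (v + (-1) *: w) (2 *: (f - T N f) + 2 *: T N g).
have := qD v ((-1) *: w).
have := qD (2 *: (f - T N f)) (2 *: T N g).
have := q2 (f - T N f); have := q2 (T N g); have := qN w.
lra.
Qed.

(* The coincidence [a + m = b + m'], padded with [a]'s on both sides, involves
   [a] an odd number of times. *)
Lemma norm_reflection_gap (R : realType) (E : set int) (n : nat)
    (p1 : 1 <= n.+2.*2%:R :> R) (a b m m' : int) (chi := char_LpE E p1) :
  E a -> E b -> E m -> E m' -> a + m = b + m' ->
  rnorm (chi a - (chi b + chi m + chi m')) ^+ n.+2.*2 + 2 <=
    rnorm (chi a + (chi b + chi m + chi m')) ^+ n.+2.*2.
Proof.
move=> Ea Eb Em Em' amb.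
set f := chi a; set g := _ + chi m'.
pose x (j : 'I_4) : int := nth 0 [:: a; b; m; m'] j.
pose e (j : 'I_4) : R := if j == ord0 then 1 else -1.
have Ex j : E (x j) by case: j => -[|[|[|[|]]]].
(* Words are taken in ['I_4], so the four frequencies need not be distinct. *)
have moment (c : 'I_4 -> R) : rnorm (\sum_j (c j)%:C *: char_LpE E p1 (x j)) ^+ n.+2.*2 =
    \sum_(phi : {ffun 'I_n.+2 -> 'I_4}) \sum_(psi : {ffun 'I_n.+2 -> 'I_4})
    (\prod_i c (phi i)) * (\prod_i c (psi i)) * (freq x phi == freq x psi)%:R.
  apply: EFin_inj; rewrite -integral_trig_even.
  have [r r0 [hr <-]] := norm_trig p1 (enum 'I_4) (fun j => (c j)%:C) x.
  congr (_ ^+ _)%:E; apply: complexI; rewrite -rnormE -hr.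
  by rewrite -(@norm_sum_char_LpE _ E)// big_enum.
have -> : f + g = \sum_j (1 : R)%:C *: char_LpE E p1 (x j).
  by rewrite !big_ord_recl big_ord0 !scale1r addr0 /g !addrA.
have -> : f - g = \sum_j (e j)%:C *: char_LpE E p1 (x j).
  rewrite !big_ord_recl big_ord0 addr0 /e/= !rmorphN1 !scaleN1r scale1r.
  by rewrite /g !opprD !addrA.
rewrite !moment.
(* [phi0] spells [a, m, a, ...] and [psi0] spells [b, m', a, ...], the default [ord0] of [nth] being
   the padding; their signs are -1 and 1. *)
pose phi0 := [ffun i : 'I_n.+2 => nth ord0 [:: ord0; inord 2] i : 'I_4].
pose psi0 := [ffun i : 'I_n.+2 => nth ord0 [:: inord 1; inord 3] i : 'I_4].
apply: (@moment_gap _ _ e x _ phi0 psi0).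
- by move=> j; rewrite /e; case: ifP => _; rewrite ?normrN normr1.
- rewrite /freq !big_ord_recl !ffunE /= /x !inordK//= !addrA amb; congr (_ + _).
  by apply: eq_bigr => i _; rewrite !ffunE.
- have e2 j : j != ord0 -> e j = -1 by rewrite /e => /negbTE ->.
  rewrite !big_ord_recl !ffunE /= !big1; last 2 first.
  + by move=> i _; rewrite ffunE /= nth_nil.
  + by move=> i _; rewrite ffunE /= nth_nil.
  rewrite !(e2 (inord _)); [|by rewrite -val_eqE /= inordK..].
  by rewrite /e eqxx; ring.
Qed.

Theorem proposition13p1p2 (R : realType) (E : set int)
    (p : nat) (p1 : 1 <= p%:R :> R)
    (p_even : ~~ odd p) (p_neq2 : p <> 2%N) (p_neq4 : p <> 4%N) :
  real_umap (LpE E p1) -> max_density R E = 0.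
Proof.
move=> umap; apply: contrapT => /exists_recurrent_difference[a Ea rec].
have [n pE] : exists n, p = n.+2.*2.
  (* [p1] excludes 0 and [p_neq2] excludes 2, so [p./2] is at least 2. *)
  exists p./2.-2; rewrite -[LHS](even_halfK p_even); congr _.*2.
  have : p != 0%N by apply/eqP => p0; have := p1; rewrite p0 ler10.
  by move: p_even p_neq2; case: (p) => [//|[//|[//|[//|k]]]] _ _ _ /=.
subst p; set q := n.+2.*2 in p1 umap *.
(* Makes the error term of [exprD_le] equal to 1, less than the gap 2. *)
pose d : R := (q%:R * 5 ^+ q)^-1.
have q1 : (1 <= q)%N by rewrite /q doubleS.
have dpos : 0 < q%:R * 5 ^+ q :> R by rewrite mulr_gt0 ?ltr0n// exprn_gt0.
have d0 : 0 < d by rewrite invr_gt0.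
have d1 : d <= 1.
  rewrite invf_le1// -[leLHS]mulr1 ler_pM//.
  by rewrite exprn_ege1// ler1n.
(* The errors are [4 * eps] from the factor [1 + eps], [3 * eps] from the reflection and [6 * eps]
   from [2 * rnorm (T g)]. *)
pose eps : R := d / 13.
have eps0 : 0 < eps by rewrite divr_gt0.
have [T [Tb Tf fT Tg]] := real_umap_reflection (char_LpE E p1 a) umap eps0.
have [//|B hB] := linear_finite_rank_char_small _ Tb Tf eps0.
(* [T] is chosen from [a], and [B] from [T]; only then are [b], [m], [m'] taken in the range where
   [T] is small. *)
have [b [Eb bB /(_ B)[m [m' [Em Em' mB m'B amb]]]]] := rec B.
pose g := char_LpE E p1 b + char_LpE E p1 m + char_LpE E p1 m'.
have [q0 qD qZ] := seminorm_rnorm E p1.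
have Tgle : rnorm (T g) <= 3 * eps.
  have := qD (T (char_LpE E p1 b + char_LpE E p1 m)) (T (char_LpE E p1 m')).
  have := qD (T (char_LpE E p1 b)) (T (char_LpE E p1 m)).
  rewrite -!linearD -/g.
  have := hB b Eb bB; have := hB m Em mB; have := hB m' Em' m'B; lra.
have fg4 : rnorm (char_LpE E p1 a - g) <= 4.
  have qN u : rnorm (- u : LpE E p1) <= rnorm u.
    by rewrite -scaleN1r; apply: le_trans (qZ _ u) _; rewrite normcN normc1 mul1r.
  have := qD (char_LpE E p1 a) (- g); have := qN g.
  have := qD (char_LpE E p1 b + char_LpE E p1 m) (char_LpE E p1 m').
  have := qD (char_LpE E p1 b) (char_LpE E p1 m).
  rewrite -/g !rnorm_char_LpE//; lra.
have gap := norm_reflection_gap p1 Ea Eb Em Em' amb; rewrite -/g in gap.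
have near : rnorm (char_LpE E p1 a + g) <= rnorm (char_LpE E p1 a - g) + d.
  have := Tg g; have : eps * rnorm (char_LpE E p1 a - g) <= eps * 4.
    by rewrite ler_wpM2l// ltW.
  rewrite (_ : d = 13 * eps); last by rewrite /eps mulrC divfK.
  lra.
(* The [q]-th powers differ by at most 1, against the 2 of [gap]. *)
have := exprD_le q (q0 _) (q0 _) fg4 (ltW d0) d1 near.
rewrite -mulrA mulVf ?gt_eqF//; lra.
Qed.
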